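(* For a graph $G$, the triple $(\mathcal{D}(G), \preceq, \smile)$ is a poset with a transitive forbidden relation (TFR poset). That is, $\preceq$ is a partial order over the set $\mathcal{D}(G)$ of DM components of $G$, and the binary relation $\smile$ over $\mathcal{D}(G)$ satisfies: (i) for each $x,y,z\in\mathcal{D}(G)$, if $x\preceq y$ and $y\smile z$ hold, then $x\smile z$ holds (transitivity); (ii) for each $x\in\mathcal{D}(G)$, $x\smile x$ does not hold (nonreflexivity); (iii) for each $x,y\in\mathcal{D}(G)$, if $x\smile y$ holds, then $y\smile x$ also holds (symmetry).
   Context: For a graph $G$ and $X\subseteq V(G)$, $G[X]$ is the subgraph induced by $X$, and $N_G(X)$ is the set of vertices in $V(G)\setminus X$ adjacent to some vertex of $X$. Let $\nu(G)$ be the number of edges in a maximum matching and $\mathrm{def}(G)=|V(G)|-2\nu(G)$. A graph is factor-critical if deleting any one vertex leaves a graph with a perfect matching (a one-vertex graph is defined to be factor-critical). $D(G)$ is the set of vertices that can be exposed (not covered) by some maximum matching, and $A(G)=N_G(D(G))$. Factor-components. An edge is allowed if it is contained in some maximum matching. Two vertices are factor-connected if they are connected by a path whose edges are allowed. A subgraph is factor-connected if any two of its vertices are factor-connected; a maximal factor-connected subgraph is a factor-component. $\mathcal{G}(G)$ is the set of factor-components of $G$. A factor-component $H$ is inconsistent if $V(H)\cap D(G)\neq\emptyset$, and consistent otherwise. Order. A set $X\subseteq V(G)$ is separating if it is the disjoint union of vertex sets of some factor-components. For $G_1,G_2\in\mathcal{G}(G)$, $G_1\triangleleft G_2$ means that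 there is a separating set $X\subseteq V(G)$ with $V(G_1)\cup V(G_2)\subseteq X$ such that the contraction $G[X]/G_1$ is factor-critical. It is known that $\triangleleft$ is a partial order over $\mathcal{G}(G)$. General Kotzig–Lovász decomposition. For $u,v\in V(G)\setminus D(G)$, $u\sim_G v$ means that $u$ and $v$ are identical, or that $u$ and $v$ are factor-connected and $\mathrm{def}(G-u-v)>\mathrm{def}(G)$. It is known that $\sim_G$ is an equivalence relation. $\mathcal{P}(G)$ is the family of its equivalence classes, and for $H\in\mathcal{G}(G)$, $\mathcal{P}_G(H)=\{S\in\mathcal{P}(G): S\subseteq V(H)\}$, which is a partition of $V(H)\setminus D(G)$. It is known that for inconsistent $H$ with $V(H)\cap A(G)\neq\emptyset$, $\mathcal{P}_G(H)=\{V(H)\cap A(G)\}$. Upper bounds. For $H\in\mathcal{G}(G)$, $U_G(H)$ (resp. $U^*_G(H)$) is the union of the vertex sets of all strict (resp. nonstrict) upper bounds of $H$ in $(\mathcal{G}(G),\triangleleft)$. It is known that for each connected component $K$ of $G[U_G(H)]$ there is $S\in\mathcal{P}_G(H)$ with $N_G(K)\cap V(H)\subseteq S$. For $S\in\mathcal{P}_G(H)$, $U_G(S)$ is the union of the vertex sets of the factor-components that are contained in a connected component $K$ of $G[U_G(H)]$ with $N_G(K)\cap V(H)\subseteq S$, and ${}^{\top}U_G(S)=U^*_G(H)\setminus S\setminus U_G(S)$. Convention for empty classes. Even for an inconsistent $H\in\mathcal{G}(G)$ with $V(H)\cap A(G)=\emptyset$, $V(H)\cap A(G)$ is treated as if it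 were a member of $\mathcal{P}(G)$; that is, one lets $\mathcal{P}_G(H)=\{V(H)\cap A(G)\}$ and ${}^{\top}U_G(V(H)\cap A(G))={}^{\top}U_G(\emptyset)=V(H)\cap D(G)=V(H)$. DM components. A DM component is a subgraph of the form $G[S\cup{}^{\top}U_G(S)]$, where $S\in\mathcal{P}(G)$, endowed with $S$ as an attribute called its base; distinct DM components can thus be the same subgraph of $G$, and a base uniquely determines a DM component. The base of a DM component $C$ is denoted $\pi(C)$, and $\mathcal{D}(G)$ is the set of DM components of $G$. Relations over $\mathcal{D}(G)$. For $D_1,D_2\in\mathcal{D}(G)$: $D_1\preceq^{\circ}D_2$ if $D_1=D_2$ or if $N_G({}^{\top}U_G(\pi(D_1)))\cap\pi(D_2)\neq\emptyset$; $D_1\preceq D_2$ if there exist $C_1,\dots,C_k\in\mathcal{D}(G)$, $k\ge1$, such that $\pi(C_1)=\pi(D_1)$, $\pi(C_k)=\pi(D_2)$, and $C_i\preceq^{\circ}C_{i+1}$ for each $i\in\{1,\dots,k\}\setminus\{k\}$; $D_1\smile^{\circ}D_2$ if $\pi(D_2)\subseteq V(D_1)\setminus\pi(D_1)$; $D_1\smile D_2$ if there exists $D'\in\mathcal{D}(G)$ with $D_1\preceq D'$ and $D'\smile^{\circ}D_2$.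
   Formalization: Since the literal claim fails for the one-vertex graph (an empty base gives x ⌣ x), D1 ⌣° D2 additionally requires π(D2) to be nonempty, and DM components with empty bases coming from different factor-components are treated as distinct. *)

(* Defs.v *)
From mathcomp Require Import all_boot.

Set Implicit Arguments.
Unset Strict Implicit.
Unset Printing Implicit Defensive.

Record sgraph := SGraph {
  vertex :> finType;
  edge : rel vertex;
  edge_sym : symmetric edge;
  edge_irrefl : irreflexive edge
}.

Section Graphs.
Variable G : sgraph.
Implicit Types (X Y K : {set G}) (M : {set {set G}}).

Definition edges : {set {set G}} :=
  [set [set p.1; p.2] | p : G * G & edge p.1 p.2].

Definition neighbours X : {set G} :=
  [set v | (v \notin X) && [exists u in X, edge u v]].

Definition matching M : bool := (M \subset edges) && trivIset M.

Definition nu : nat := \max_(M : {set {set G}} | matching M) #|M|.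

(* Truncated subtraction is harmless: a matching covers 2 * #|M| vertices. *)
Definition deficiency : nat := #|G| - 2 * nu.

Definition max_matching M : bool := matching M && (#|M| == nu).

Definition perfect_matching M : bool :=
  matching M && (cover M == [set: G]).

Definition has_perfect_matching : bool :=
  [exists M : {set {set G}}, perfect_matching M].

Section Induced.
Variable X : {set G}.

Definition induced_vertex : finType := {x : G | x \in X}.

Definition induced_edge : rel induced_vertex :=
  fun x y => edge (val x) (val y).

Lemma induced_edge_sym : symmetric induced_edge.
Proof. by move=> x y; rewrite /induced_edge edge_sym. Qed.

Lemma induced_edge_irrefl : irreflexive induced_edge.
Proof. by move=> x; rewrite /induced_edge edge_irrefl. Qed.

Definition induced : sgraph := SGraph induced_edge_sym induced_edge_irrefl.

End Induced.

(* The contraction G/X: [None] is the vertex obtained by identifying X; loops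
   and parallel edges are discarded. *)
Section Contraction.
Variable X : {set G}.

Definition contract_vertex : finType := option {x : G | x \notin X}.

Definition contract_edge : rel contract_vertex := fun a b =>
  match a, b with
  | Some x, Some y => edge (val x) (val y)
  | Some x, None => [exists u in X, edge u (val x)]
  | None, Some y => [exists u in X, edge u (val y)]
  | None, None => false
  end.

Lemma contract_edge_sym : symmetric contract_edge.
Proof. by case=> [x|] [y|] //=; rewrite edge_sym. Qed.

Lemma contract_edge_irrefl : irreflexive contract_edge.
Proof. by case=> [x|] //=; rewrite edge_irrefl. Qed.

Definition contract : sgraph := SGraph contract_edge_sym contract_edge_irrefl.

End Contraction.

(* Vertex sets of the connected components of G[X]. *)
Definition components X : {set {set G}} :=
  equivalence_partition
    (connect [rel x y : G | [&& x \in X, y \in X & edge x y]]) X.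

End Graphs.

(* For a one-vertex graph this holds through the empty matching. *)
Definition factor_critical (G : sgraph) : bool :=
  [forall v : G, has_perfect_matching (induced (~: [set v]))].

Section Decomposition.
Variable G : sgraph.
Implicit Types (X H K S : {set G}) (u v : G).

Definition Dset : {set G} :=
  [set v | [exists M : {set {set G}}, max_matching M && (v \notin cover M)]].

Definition Aset : {set G} := neighbours Dset.

(* A factor-component is an induced subgraph and is represented by its vertex
   set. *)

Definition allowed : rel G := fun u v =>
  edge u v &&
  [exists M : {set {set G}}, max_matching M && ([set u; v] \in M)].

Definition factor_connected : rel G := connect allowed.

Definition factor_connected_set X : bool :=
  (X != set0) && [forall u in X, forall v in X, factor_connected u v].

Definition factor_components : {set {set G}} :=
  [set H : {set G} | maxset factor_connected_set H].

Definition inconsistent H : bool := H :&: Dset != set0.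

Definition separating X : bool :=
  [exists F : {set {set G}},
     [&& F \subset factor_components, trivIset F & cover F == X]].

(* H1 lies inside G[X], so it is pulled back along [val] before contracting. *)
Definition fc_le H1 H2 : bool :=
  [exists X : {set G},
     [&& separating X, H1 :|: H2 \subset X &
         factor_critical
           (contract [set x : induced X | val x \in H1])]].

Definition gkl u v : bool :=
  (u == v) ||
  (factor_connected u v &&
   (deficiency G < deficiency (induced (~: [set u; v])))).

Definition gkl_classes : {set {set G}} :=
  equivalence_partition gkl (~: Dset).

(* The factor-components to which the convention for empty classes applies. *)
Definition exceptional H : bool := inconsistent H && (H :&: Aset == set0).

Definition gkl_of H : {set {set G}} :=
  if exceptional H then [set H :&: Aset]
  else [set S in gkl_classes | S \subset H].

Definition Ustrict H : {set G} :=
  \bigcup_(H' in factor_components | fc_le H H' && (H' != H)) H'.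

Definition Unonstrict H : {set G} :=
  \bigcup_(H' in factor_components | fc_le H H') H'.

(* U_G(S) and its counterpart; the factor-component H with S in P_G(H) is an
   explicit argument because the empty class does not determine it. *)
Definition Ubase H S : {set G} :=
  \bigcup_(H' in factor_components |
     [exists K in components (Ustrict H),
        (neighbours K :&: H \subset S) && (H' \subset K)]) H'.

Definition topU H S : {set G} :=
  if exceptional H then H :&: Dset
  else (Unonstrict H :\: S) :\: Ubase H S.

(* A DM component is given by its base S together with the factor-component H
   such that S is in P_G(H). For nonempty S the set H is determined by S; for
   the empty classes it tells apart the classes of different H, so that each
   of them yields its own DM component. *)

Definition is_dm_base (p : {set G} * {set G}) : bool :=
  (p.1 \in factor_components) && (p.2 \in gkl_of p.1).

Definition dm_component : finType :=
  {p : {set G} * {set G} | is_dm_base p}.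

Definition dm_base (C : dm_component) : {set G} := (val C).2.

Definition dm_topU (C : dm_component) : {set G} := topU (val C).1 (val C).2.

Definition dm_verts (C : dm_component) : {set G} := dm_base C :|: dm_topU C.

Definition dm_graph (C : dm_component) : sgraph := induced (dm_verts C).

Definition dm_le0 : rel dm_component := fun C1 C2 =>
  (C1 == C2) || (neighbours (dm_topU C1) :&: dm_base C2 != set0).

(* The chain is C1 :: s; its members are determined by their bases. *)
Definition dm_le (C1 C2 : dm_component) : Prop :=
  exists s : seq dm_component, path dm_le0 C1 s /\ last C1 s = C2.

(* The bare inclusion holds vacuously when the base of C2 is empty (already
   between the DM component of a one-vertex graph and itself); an empty base
   does not count as lying inside another set of vertices. *)
Definition dm_forbid0 (C1 C2 : dm_component) : Prop :=
  dm_base C2 != set0 /\ dm_base C2 \subset dm_verts C1 :\: dm_base C1.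

Definition dm_forbid (C1 C2 : dm_component) : Prop :=
  exists C : dm_component, dm_le C1 C /\ dm_forbid0 C C2.

End Decomposition.

Section TFR.
Variables (T : Type) (le forbid : T -> T -> Prop).

Definition partial_order : Prop :=
  [/\ forall x, le x x,
      forall x y, le x y -> le y x -> x = y &
      forall x y z, le x y -> le y z -> le x z].

Definition tfr_poset : Prop :=
  [/\ partial_order,
      forall x y z, le x y -> forbid y z -> forbid x z,
      forall x, ~ forbid x x &
      forall x y, forbid x y -> forbid y x].

End TFR.

(* Main.v *)
(* Matchings are encoded as involutions. For s outside D(G), let E(s) be the set of
   v <> s such that deleting s and v does not increase the deficiency, i.e.
   D(G - s) without s, and let B(s) = N(E(s)), i.e. A(G - s) with s. By
   Gallai-Edmonds theory for G - s, B(s) is a barrier whose odd components are the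
   components of G[E(s)]; hence t \in B(s) iff E(t) \subset E(s), and t \in E(s) iff
   s \in E(t). Among the vertices of C(G), the sets E(s) and E(t) coincide iff s and
   t are in the same class of the general Kotzig-Lovasz decomposition.

   For a class S of a consistent factor-component H and s \in S one shows that
   topU(S) \subset E(s) and that N(topU(S)) is disjoint from E(s): the strict upper
   bounds of H avoid B(s), and every component of G[E(s)] meeting H, added to H,
   gives a separating set whose contraction by H is factor-critical. So S <= T
   implies E(t) \subset E(s), which gives antisymmetry. A closure argument (the
   union of topU over the classes above S has no neighbour in E(s) outside
   itself, and its boundary is matched into it) shows that E(s) is covered by these topU;
   so S and T are in the forbidden relation iff t \in E(s), which is a symmetric
   and irreflexive condition. DM components of inconsistent factor-components are maximal
   and take no part
   in the forbidden relation. *)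

Require Import Defs.
From mathcomp Require Import all_boot zify.

Set Implicit Arguments.
Unset Strict Implicit.
Unset Printing Implicit Defensive.

(** * Matchings as involutions *)

Section Matings.
Variable G : sgraph.
Implicit Types (f g h : {ffun G -> G}) (T X Y Z : {set G}) (x y z : G).

(* Fixed points are the exposed vertices; those of [T] are required to be exposed. *)
Definition mating T f :=
  [forall x, [&& f (f x) == x, (f x != x) ==> edge x (f x) & (x \in T) ==> (f x == x)]].

Lemma matingP T f :
  reflect [/\ involutive f, forall x, f x != x -> edge x (f x)
            & {in T, forall x, f x = x}] (mating T f).
Proof.
apply: (iffP forallP) => [h|[h1 h2 h3] x].
  split=> [x|x fx|x xT]; have /and3P[/eqP k1 k2 k3] := h x => //.
    exact: (implyP k2).
  exact/eqP/(implyP k3).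
apply/and3P; split; first exact/eqP.
  exact/implyP/h2.
by apply/implyP => xT; apply/eqP/h3.
Qed.

Lemma mating_inv T f : mating T f -> involutive f.
Proof. by case/matingP. Qed.

Lemma mating_edge T f x : mating T f -> f x != x -> edge x (f x).
Proof. by case/matingP=> _ h _ /h. Qed.

Lemma mating_fix T f x : mating T f -> x \in T -> f x = x.
Proof. by case/matingP=> _ _ h /h. Qed.

Lemma mating_out T f x : mating T f -> x \notin T -> f x \notin T.
Proof.
by move=> fm; apply: contra => xT; rewrite -(mating_inv fm x) (mating_fix fm xT).
Qed.

Lemma matingS T T' f : T' \subset T -> mating T f -> mating T' f.
Proof.
move=> sT /matingP[h1 h2 h3]; apply/matingP; split=> // x xT.
exact/h3/(subsetP sT).
Qed.

Definition fixes f := [set x | f x == x].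

Lemma in_fixes f x : (x \in fixes f) = (f x == x).
Proof. by rewrite inE. Qed.

Lemma matingU T T' f : mating T f -> T' \subset fixes f -> mating (T' :|: T) f.
Proof.
case/matingP=> h1 h2 h3 /subsetP sT; apply/matingP; split=> // x.
by rewrite inE => /orP[/sT|/h3//]; rewrite inE => /eqP.
Qed.

Definition unmatch f X : {ffun G -> G} :=
  [ffun z => if (z \in X) || (f z \in X) then z else f z].

Lemma unmatch_mating T f X : mating T f -> mating (X :|: T) (unmatch f X).
Proof.
case/matingP=> fK fe fT; apply/matingP; split=> [x|x|x].
- rewrite !ffunE; case: (boolP ((x \in X) || (f x \in X))) => [->//|/negPf h].
  by rewrite fK orbC h.
- by rewrite ffunE; case: ifP => [|_ /fe//]; rewrite eqxx.
rewrite inE ffunE => /orP[->//|xT].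
by rewrite fT // if_same.
Qed.

Lemma fixes_unmatch T f X : mating T f ->
  fixes (unmatch f X) = fixes f :|: X :|: [set f x | x in X].
Proof.
move=> /mating_inv fK; apply/setP=> z; rewrite !inE ffunE.
case: ifP => [|/norP[/negPf zX /negPf fzX]].
  rewrite eqxx => /orP[->|fz]; first by rewrite orbT.
  by rewrite -(fK z) imset_f ?orbT.
rewrite zX orbF; case: (f z == z) => //=; symmetry; apply/negP => /imsetP[x xX zx].
by rewrite zx fK xX in fzX.
Qed.

(** Only a vertex of [X] that [f] matches contributes anything new: itself and its mate. *)
Lemma card_unmatch T f X : mating T f ->
  #|fixes (unmatch f X)| + 2 * #|fixes f :&: X| <= #|fixes f| + 2 * #|X|.
Proof.
move=> fm; rewrite (fixes_unmatch _ fm).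
have -> : fixes f :|: X :|: [set f x | x in X] =
  fixes f :|: (X :\: fixes f) :|: [set f x | x in X :\: fixes f].
  apply/setP=> z; rewrite !inE.
  case: (f z =P z) => //= fz; rewrite orbC [RHS]orbC; congr orb.
  apply/imsetP/imsetP=> -[x xX zx]; exists x => //.
    rewrite !inE xX andbT; apply/eqP=> fx.
    by rewrite zx fx in fz.
  by move: xX; rewrite inE => /andP[].
set Y := X :\: fixes f.
have h1 : #|[set f x | x in Y]| <= #|Y| := leq_imset_card _ _.
have h2 := leq_of_leqif (leq_card_setU (fixes f :|: Y) [set f x | x in Y]).
have h3 := leq_of_leqif (leq_card_setU (fixes f) Y).
have h4 : #|fixes f :&: X| + #|Y| = #|X| by rewrite setIC cardsID.
lia.
Qed.

Definition rmv f x := unmatch f [set x].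

Lemma rmvE T f x z : mating T f ->
  rmv f x z = if (z == x) || (z == f x) then z else f z.
Proof.
move=> /mating_inv fK; rewrite ffunE !inE.
by rewrite -[z == f x](can_eq fK) fK.
Qed.

Lemma rmv_mating T f x : mating T f -> mating (x |: T) (rmv f x).
Proof. exact: unmatch_mating. Qed.

Lemma fixes_rmv T f x : mating T f -> fixes (rmv f x) = x |: (f x |: fixes f).
Proof.
move=> fm; rewrite (fixes_unmatch _ fm) imset_set1.
by apply/setP=> z; rewrite !inE; do 3 case: (_ == _).
Qed.

Lemma card_rmv T f x : mating T f -> f x != x ->
  #|fixes (rmv f x)| = #|fixes f| + 2.
Proof.
move=> fm fx; rewrite (fixes_rmv _ fm) !cardsU1 !inE (mating_inv fm).
by rewrite (eq_sym x) (negPf fx) /=; lia.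
Qed.

Definition add f x y : {ffun G -> G} :=
  [ffun z => if z == x then y else if z == y then x else f z].

Lemma edge_neq x y : edge x y -> x != y.
Proof. by apply: contraTneq => ->; rewrite edge_irrefl. Qed.

Lemma add_mating T f x y : mating T f -> f x = x -> f y = y -> edge x y ->
  x \notin T -> y \notin T -> mating T (add f x y).
Proof.
case/matingP=> fK fe fT fx fy exy xT yT; apply/matingP; split=> [z|z|z zT].
- rewrite !ffunE; case: (z =P x) => [->|/eqP zx].
    by rewrite eqxx; case: (y =P x).
  case: (z =P y) => [->|/eqP zy]; first by rewrite eqxx.
  by rewrite -{1}fx -{2}fy !(can_eq fK) (negPf zx) (negPf zy) fK.
- rewrite !ffunE; case: (z =P x) => [->//|_].
  by case: (z =P y) => [-> _|_ /fe//]; rewrite edge_sym.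
rewrite ffunE; case: eqP zT xT => [->->//|_ zT _].
by case: eqP zT yT => [->->//|_ zT _]; apply: fT.
Qed.

Lemma fixes_add f x y : edge x y -> fixes (add f x y) = fixes f :\ x :\ y.
Proof.
move=> /edge_neq xy; apply/setP=> z; rewrite !inE ffunE.
case: (z =P x) => [->|_]; first by rewrite andbF eq_sym (negPf xy).
by case: (z =P y) => [->|//]; rewrite (negPf xy).
Qed.

Lemma card_add f x y : f x = x -> f y = y -> edge x y ->
  #|fixes (add f x y)| + 2 = #|fixes f|.
Proof.
move=> fx fy exy; have xy := edge_neq exy.
rewrite fixes_add // (cardsD1 x (fixes f)) (cardsD1 y (fixes f :\ x)) !inE fx fy !eqxx.
by rewrite eq_sym xy /=; lia.
Qed.

(** Breaking one edge exposes two more vertices, and breaking all of them leads to the identity. *)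
Lemma odd_fixes T f : mating T f -> odd #|fixes f| = odd #|G|.
Proof.
have [n] := ubnP #|~: fixes f|; elim: n f => // n IHn f lt_n fm.
have [fx|[x]] := set_0Vmem (~: fixes f).
  by rewrite -(cardsC (fixes f)) fx cards0 addn0.
rewrite !inE => fx.
have fm1 : mating T (rmv f x) by apply: matingS (rmv_mating x fm); apply: subsetUr.
have c1 := card_rmv fm fx.
rewrite -(IHn _ _ fm1) ?c1; first by rewrite oddD addbF.
by have := cardsC (fixes (rmv f x)); have := cardsC (fixes f); lia.
Qed.

(* The deficiency of [G - T], plus [#|T|]. *)
Definition dfc T :=
  #|fixes [arg min_(f < [ffun x => x] | mating T f) #|fixes f|]|.

Lemma id_mating T : mating T [ffun x => x].
Proof. by apply/matingP; split=> [x|x|x]; rewrite !ffunE ?eqxx. Qed.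

Lemma dfc_le T f : mating T f -> dfc T <= #|fixes f|.
Proof.
by rewrite /dfc; case: arg_minnP => [|h _ hmin]; [exact: id_mating | exact: hmin].
Qed.

Definition optimal T f := mating T f && (#|fixes f| == dfc T).

Lemma optimal_ex T : exists f, optimal T f.
Proof.
rewrite /optimal /dfc; case: arg_minnP => [|h hm _]; first exact: id_mating.
by exists h; rewrite hm eqxx.
Qed.

Lemma optimal_mating T f : optimal T f -> mating T f.
Proof. by case/andP. Qed.

Lemma optimal_card T f : optimal T f -> #|fixes f| = dfc T.
Proof. by case/andP=> _ /eqP. Qed.

(** This is D(G - T) with [T] added, because a mating for [T] fixes [T] pointwise. *)
Definition exposable T := [set v | [exists f : {ffun G -> G}, optimal T f && (f v == v)]].

Lemma exposableP T v :
  reflect (exists2 f, optimal T f & f v = v) (v \in exposable T).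
Proof.
rewrite inE; apply: (iffP existsP) => [[f /andP[fo /eqP fv]]|[f fo fv]]; first by exists f.
by exists f; rewrite fo fv eqxx.
Qed.

Lemma exposable_sub T : T \subset exposable T.
Proof.
apply/subsetP=> x xT; have [f fo] := optimal_ex T.
by apply/exposableP; exists f => //; apply: mating_fix (optimal_mating fo) xT.
Qed.

(* Exchange along the path of the symmetric difference of [f] and [g] that
   starts at [y] and ends at [w]. *)
Lemma swap T f g y : mating T f -> mating T g -> g y = y ->
  exists f' g' w,
   [/\ [/\ mating T f', mating T g' & connect [rel a b | (f a == b) || (g a == b)] y w],
       [/\ f' y = y, g' y = f y, f' w = g w & g' w = f w],
       forall z, z != y -> z != w ->
         (f' z == z) = (f z == z) /\ (g' z == z) = (g z == z),
       forall z, f z = g z -> f' z = f z /\ g' z = f z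
     & f y = y /\ w = y \/ [/\ f y != y, w != y & (f w == w) (+) (g w == w)]].
Proof.
have [n] := ubnP #|[set z | f z != g z]|; elim: n g y => // n IHn g y ltn fm gm gy.
case: (f y =P y) => [fy|/eqP fy].
  by exists f, g, y; rewrite gy fy; split=> //; left.
have fK := mating_inv fm; have gK := mating_inv gm.
set y1 := f y in fy *.
have efy : edge y y1 := mating_edge fm fy.
have yT : y \notin T by apply: contra fy => /(mating_fix fm) h; apply/eqP.
have y1T : y1 \notin T.
  by apply: contra fy => /(mating_fix fm); rewrite fK /y1 => <-.
(* The path is the single edge [y y1], which passes from [f] to [g]. *)
case: (g y1 =P y1) => [gy1|/eqP gy1].
  have rE := rmvE y _ fm.
  exists (rmv f y), (add g y y1), y1; split.
  - split; last by apply: connect1; rewrite /= eqxx.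
      exact: matingS (subsetUr _ _) (rmv_mating y fm).
    exact: add_mating.
  - by rewrite !rE !ffunE !eqxx orbT gy1 (negPf fy) fK.
  - by move=> z zy zy1; rewrite rE ffunE (negPf zy) (negPf zy1).
  - move=> z fgz; rewrite rE ffunE.
    case: (z =P y) => [zy|_]; first by move: fy; rewrite /y1 -{1}zy fgz zy gy eqxx.
    case: (z =P y1) => [zy|_]; last by rewrite /= fgz.
    by move: fy; rewrite -gy1 -{1}zy -fgz zy fK eqxx.
  right; split=> //; rewrite gy1 fK eqxx.
  by rewrite eq_sym (negPf fy).
set y2 := g y1 in gy1 *.
have egy : edge y1 y2 := mating_edge gm gy1.
have y2T : y2 \notin T.
  by apply: contra gy1 => /(mating_fix gm); rewrite gK /y2 => <-.
have y2y : y2 != y.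
  by rewrite -gy (can_eq gK).
(* [g2] takes over the edge [y y1] and exposes [y2]; it disagrees with [f] at fewer vertices, and
   the rest of the path starts at [y2]. *)
set g2 := add (rmv g y1) y y1.
have rE := rmvE y1 _ gm.
have g2E z : g2 z = if z == y then y1 else if z == y1 then y else
     if z == y2 then y2 else g z.
  rewrite ffunE; case: ifP => // zy; case: ifP => // zy1; rewrite rE zy1 -/y2.
  by case: eqP => [->|].
have g2m : mating T g2.
  apply: add_mating => //.
  - exact: matingS (subsetUr _ _) (rmv_mating _ gm).
  - by rewrite rE [y == y1]eq_sym (negPf fy) [y == _]eq_sym (negPf y2y).
  - by rewrite rE eqxx.
have g2y2 : g2 y2 = y2 by rewrite g2E (negPf y2y) (negPf gy1) eqxx.
have [|f2 [g3 [w [[f2m g3m yw] [f2y g3y f2w g3w] fixs same kind]]]] :=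
    IHn g2 y2 _ fm g2m g2y2.
  rewrite -ltnS; apply: leq_trans ltn; rewrite ltnS.
  apply: proper_card; apply/properP; split.
    apply/subsetP=> z; rewrite !inE g2E.
    case: (z =P y) => [->|_]; first by rewrite eqxx.
    case: (z =P y1) => [->|_]; first by rewrite fK eqxx.
    case: (z =P y2) => [-> _|//]; rewrite gK -[X in _ != X](fK y1) fK.
    by rewrite (can_eq fK).
  by exists y; rewrite !inE ?gy // g2E eqxx negbK.
have [f2y0 g3y0] : f2 y = y1 /\ g3 y = y1 by apply: same; rewrite g2E eqxx.
have [f2y1 g3y1] : f2 y1 = y /\ g3 y1 = y.
  by have := same y1; rewrite g2E (negPf fy) eqxx fK => /(_ erefl).
have [wy wy1] : w != y /\ w != y1.
  case: kind => [[_ ->//]|[_ _ kw]].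
  split; apply: contraTneq kw => ->.
    by rewrite g2E eqxx -/y1 (negPf fy).
  by rewrite g2E (negPf fy) eqxx fK eq_sym (negPf fy).
have f2K := mating_inv f2m.
have rE2 := rmvE y _ f2m.
(* [f2] still has the edge [y y1], on which [f] and [g2] agree; trading it for [y1 y2] completes the
   exchange. *)
set f' := add (rmv f2 y) y1 y2.
have f'E z : f' z = if z == y1 then y2 else if z == y2 then y1 else
    if z == y then y else f2 z.
  rewrite ffunE; case: ifP => // zy1; case: ifP => // zy2; rewrite rE2 f2y0 zy1 orbF.
  by case: eqP => [->|].
have yw' : connect [rel a b | (f a == b) || (g a == b)] y w.
  apply: (@connect_trans _ _ y1); first by apply: connect1; rewrite /= eqxx.
  apply: (@connect_trans _ _ y2); first by apply: connect1; rewrite /= eqxx orbT.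
  have sub : subrel (connect [rel a b | (f a == b) || (g2 a == b)])
                    (connect [rel a b | (f a == b) || (g a == b)]).
    apply: connect_sub => a b /orP[h|]; first by apply: connect1; rewrite /= h.
    rewrite g2E; case: (a =P y) => [-> /eqP <-|_].
      by apply: connect1; rewrite /= eqxx.
    case: (a =P y1) => [-> /eqP <-|_]; first by apply: connect1; rewrite /= fK eqxx.
    case: (a =P y2) => [-> /eqP <-|_ h]; first exact: connect0.
    by apply: connect1; rewrite /= h orbT.
  exact: sub.
exists f', g3, w; split.
- split=> //; apply: add_mating => //.
  + exact: matingS (subsetUr _ _) (rmv_mating _ f2m).
  + by rewrite rE2 f2y0 eqxx orbT.
  + by rewrite rE2 f2y if_same.
- rewrite !f'E eqxx [y == y1]eq_sym (negPf fy) [y == y2]eq_sym (negPf y2y).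
  rewrite (negPf wy) (negPf wy1); split=> //.
  case: (w =P y2) => [->|/eqP wy2]; first by rewrite gK.
  by rewrite f2w g2E (negPf wy) (negPf wy1) (negPf wy2).
- move=> z zy zw; rewrite f'E (negPf zy).
  case: (z =P y1) => [->|/eqP zy1].
    rewrite fK g3y1; split; first by rewrite (negPf gy1) eq_sym (negPf fy).
    by rewrite (negPf gy1) eq_sym (negPf fy).
  case: (z =P y2) => [zy2|/eqP zy2].
    case: kind => [[_ ww]|[fy2 _ _]]; first by rewrite zy2 ww eqxx in zw.
    by rewrite zy2 g3y gK [y1 == _]eq_sym (negPf fy2) (negPf gy1).
  have [-> ->] := fixs z zy2 zw.
  by rewrite g2E (negPf zy) (negPf zy1) (negPf zy2).
- move=> z fgz; rewrite f'E.
  case: (z =P y) => [zy|/eqP zy].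
    by move: fy; rewrite /y1 -{1}zy fgz zy gy eqxx.
  case: (z =P y1) => [zE|/eqP zy1].
    by move: fgz y2y; rewrite zE fK -/y2 => ->; rewrite eqxx.
  case: (z =P y2) => [zE|/eqP zy2].
    by move/(congr1 f): fgz y2y; rewrite zE gK !fK => ->; rewrite eqxx.
  by apply: same; rewrite g2E (negPf zy) (negPf zy1) (negPf zy2).
right; split=> //.
case: kind => [[fy2 ->]|[fy2 wy2 kw]].
  by rewrite fy2 eqxx gK eq_sym (negPf gy1).
by move: kw; rewrite g2E (negPf wy) (negPf wy1) (negPf wy2).
Qed.

End Matings.

(** * Gallai's lemma and stability *)

Section Exposable.
Variable G : sgraph.
Implicit Types (f g h : {ffun G -> G}) (T X Y Z : {set G}) (s t x y z : G).

(** The path from [y] either ends at a vertex missed by [f], and both sizes are kept, or at one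
    missed by [g], and two exposed vertices pass from [g] to [f]. The second case is impossible when
    [g] is optimal. *)
Lemma exchange T f g y : mating T f -> mating T g -> g y = y -> f y != y ->
  exists f' g' w,
   [/\ mating T f', mating T g', connect [rel a b | (f a == b) || (g a == b)] y w, w != y
     & [/\ f w = w, fixes f' = y |: fixes f :\ w, fixes g' = w |: fixes g :\ y,
           #|fixes f'| = #|fixes f| & #|fixes g'| = #|fixes g| ] \/
       [/\ g w = w, fixes f' = y |: (w |: fixes f), fixes g' = fixes g :\ y :\ w,
           #|fixes f'| = #|fixes f| + 2 & #|fixes g'| + 2 = #|fixes g| ] ].
Proof.
move=> fm gm gy fy.
have [f' [g' [w [[f'm g'm yw] [f'y g'y f'w g'w] fixs _ kind]]]] := swap fm gm gy.
case: kind => [[fy0]|[_ wy kw]]; first by rewrite fy0 eqxx in fy.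
exists f', g', w; split=> //.
have yw0 : y != w by rewrite eq_sym.
case: (f w =P w) kw => fw; last first.
  move=> /eqP gw; right.
  have E1 : fixes f' = y |: (w |: fixes f).
    apply/setP=> z; rewrite !inE; case: (z =P y) => [->|/eqP zy]; first by rewrite f'y eqxx.
    case: (z =P w) => [->|/eqP zw]; first by rewrite f'w gw eqxx.
    by have [-> _] := fixs z zy zw.
  have E2 : fixes g' = fixes g :\ y :\ w.
    apply/setP=> z; rewrite !inE; case: (z =P w) => [->|/eqP zw].
      by rewrite g'w; apply/eqP.
    case: (z =P y) => [->|/eqP zy]; first by rewrite g'y (negPf fy).
    by have [_ ->] := fixs z zy zw.
  split=> //.
    by rewrite E1 !cardsU1 !inE (negPf yw0) (negPf fy) (introF eqP fw) /=; lia.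
  by rewrite E2 (cardsD1 y (fixes g)) (cardsD1 w (fixes g :\ y)) !inE gy gw !eqxx wy /=; lia.
rewrite addTb => gw; left.
have E1 : fixes f' = y |: fixes f :\ w.
  apply/setP=> z; rewrite !inE; case: (z =P y) => [->|/eqP zy]; first by rewrite f'y eqxx.
  case: (z =P w) => [->|/eqP zw]; first by rewrite f'w (negPf gw).
  by have [-> _] := fixs z zy zw.
have E2 : fixes g' = w |: fixes g :\ y.
  apply/setP=> z; rewrite !inE; case: (z =P w) => [->|/eqP zw]; first by rewrite g'w fw eqxx.
  case: (z =P y) => [->|/eqP zy]; first by rewrite g'y (negPf fy).
  by have [_ ->] := fixs z zy zw.
split=> //.
  by rewrite E1 cardsU1 (cardsD1 w (fixes f)) !inE fw eqxx (negPf fy) andbF.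
by rewrite E2 cardsU1 (cardsD1 y (fixes g)) !inE gy eqxx (negPf gw) andbF.
Qed.

Definition within X : rel G := [rel x y : G | [&& x \in X, y \in X & edge x y]].

Lemma within_sym X : connect_sym (within X).
Proof.
by apply: sym_connect_sym => x y; rewrite /within /= edge_sym andbCA.
Qed.

Lemma within1 X x y : x \in X -> y \in X -> edge x y -> connect (within X) x y.
Proof. by move=> xX yX xy; apply: connect1; apply/and3P. Qed.

Lemma within_mem X x y : connect (within X) x y -> x \in X -> y \in X.
Proof.
case/connectP=> p; elim: p x => [|z p IHp] x /=; first by move=> _ ->.
by case/andP=> /and3P[_ zX _] pzp ly _; apply: IHp ly zX.
Qed.

(* Gallai's lemma: not being missed simultaneously is a transitive relation on
   the exposable vertices. *)
Lemma gallai T f x y : connect (within (exposable T :\: T)) x y -> x != y ->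
  optimal T f -> f x = x -> f y = y -> False.
Proof.
pose R x y := x = y \/ forall f, optimal T f -> f x = x -> f y = y -> False.
(* If [f] misses [u] and [w], exchanging it with an optimal mating that misses [v] makes it miss [v]
   at the expense of at most one of [u] and [w]. *)
have Rtr u v w : v \in exposable T -> R u v -> R v w -> R u w.
  move=> /exposableP[g go gv] [->//|uv] [<-|vw]; first by right.
  have [->|uw] := eqVneq u w; first by left.
  right=> {}f fo fu fw.
  have fv : f v != v by apply/eqP=> fv; apply: uv fo fu fv.
  have fm := optimal_mating fo; have gm := optimal_mating go.
  have cf := optimal_card fo; have cg := optimal_card go.
  have [f' [g' [z [f'm g'm _ zv []]]]] := exchange fm gm gv fv; last first.
    by case=> _ _ _ _ cg'; have := dfc_le g'm; rewrite -cg -cg' addn2 ltnNge leqnSn.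
  case=> fz Ef' _ cf' _.
  have f'o : optimal T f' by rewrite /optimal f'm cf' cf eqxx.
  have f'fix a : f a = a -> a != z -> f' a = a.
    by move=> fa az; apply/eqP; rewrite -in_fixes Ef' !inE az fa eqxx orbT.
  have f'v : f' v = v by apply/eqP; rewrite -in_fixes Ef' !inE eqxx.
  have [zu|zu] := eqVneq z u.
    by apply: (vw f' f'o f'v (f'fix _ fw _)); rewrite zu eq_sym.
  by apply: (uv f' f'o (f'fix _ fu _) f'v); rewrite eq_sym.
move=> cxy xy fo fx fy.
suff [exy|h] : R x y; [by rewrite exy eqxx in xy | exact: h fo fx fy |].
case/connectP: cxy => p; elim: p x {fx fy xy} => [|z p IHp] x /= => [_ ->|]; first by left.
case/andP=> /and3P[xX zX xz] pp ly.
apply: Rtr (IHp _ pp ly); first by move: zX; rewrite inE => /andP[].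
(* Two adjacent vertices missed together could be joined, against optimality. *)
right=> {}f {}fo fx fz.
have [[_ xT] [_ zT]] : (x \in exposable T /\ x \notin T) /\ (z \in exposable T /\ z \notin T).
  by move: xX zX; rewrite !inE => /andP[-> ->] /andP[-> ->].
have := dfc_le (add_mating (optimal_mating fo) fx fz xz xT zT).
have := card_add fx fz xz; rewrite (optimal_card fo).
lia.
Qed.

(** Breaking the edge at [t] bounds the rise by two; no rise would make [t] exposable, and parity
    excludes a rise by one. *)
Lemma dfcU1 T t : t \notin exposable T -> dfc (t |: T) = dfc T + 2.
Proof.
move=> tD; have [f fo] := optimal_ex T; have [g go] := optimal_ex (t |: T).
have fm := optimal_mating fo; have gm := matingS (subsetUr _ _) (optimal_mating go).
have ft : f t != t by apply: contra tD => /eqP ft; apply/exposableP; exists f.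
have h1 := dfc_le (rmv_mating t fm).
rewrite (card_rmv fm ft) (optimal_card fo) in h1.
have gt : g t = t by apply: mating_fix (optimal_mating go) _; rewrite !inE eqxx.
have h2 := dfc_le gm; rewrite (optimal_card go) in h2.
have h3 := odd_fixes fm; rewrite -(odd_fixes gm) (optimal_card go) (optimal_card fo) in h3.
have h4 : dfc (t |: T) != dfc T.
  apply: contra tD => /eqP h4; apply/exposableP; exists g => //.
  by rewrite /optimal gm (optimal_card go) h4 eqxx.
by move: h1 h2 h3 h4; clear; lia.
Qed.

(** Gallai's stability lemma, for [t] in A(G - T): a mating that exposes [t], [y] and [r] becomes
    optimal for [T] once [t] and [y] are joined, and still misses [r]. *)
Lemma stability T t y : t \notin exposable T -> y \in exposable T -> y \notin T ->
  edge t y -> exposable (t |: T) = t |: exposable T.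
Proof.
move=> tD yD yT ty; have dE := dfcU1 tD.
have tT : t \notin T by apply: contra tD; apply: (subsetP (exposable_sub T)).
apply/eqP; rewrite eqEsubset; apply/andP; split; apply/subsetP=> r; last first.
  case/setU1P=> [->|/exposableP[f fo fr]].
    by apply: (subsetP (exposable_sub (t |: T))); rewrite !inE eqxx.
  apply/exposableP; exists (rmv f t).
    have fm := optimal_mating fo.
    have ft : f t != t by apply: contra tD => /eqP ft; apply/exposableP; exists f.
    by rewrite /optimal rmv_mating // (card_rmv fm ft) (optimal_card fo) dE eqxx.
  by rewrite (rmvE _ _ (optimal_mating fo)) fr if_same.
case/exposableP=> f fo fr; rewrite in_setU1.
have [//|rt /=] := eqVneq r t.
have ft : f t = t by apply: mating_fix (optimal_mating fo) _; rewrite !inE eqxx.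
have fm := matingS (subsetUr _ _) (optimal_mating fo).
have cf := optimal_card fo; rewrite dE in cf.
have [->//|ry] := eqVneq r y.
have addo h : mating T h -> h t = t -> h y = y -> h r = r -> #|fixes h| = dfc T + 2 ->
    r \in exposable T.
  move=> hm ht hy hr ch; apply/exposableP; exists (add h t y).
    by rewrite /optimal add_mating //= -(eqn_add2r 2) card_add // ch.
  by rewrite ffunE (negPf rt) (negPf ry).
have [fy|fy] := eqVneq (f y) y; first exact: (addo f).
(* If [f] covers [y], it is first exchanged with an optimal mating that misses [y]; the vertex [w]
   lost in return is exposable, hence distinct from [t]. *)
have /exposableP[g go gy] := yD.
have gm := optimal_mating go; have cg := optimal_card go.
have [f' [g' [w [f'm g'm _ wy []]]]] := exchange fm gm gy fy; last first.
  by case=> _ _ _ _ cg'; have := dfc_le g'm; rewrite -cg -cg' addn2 ltnNge leqnSn.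
case=> fw Ef' Eg' cf' cg'.
have wD : w \in exposable T.
  apply/exposableP; exists g'; first by rewrite /optimal g'm cg' cg eqxx.
  by apply/eqP; rewrite -in_fixes Eg' !inE eqxx.
have [->//|rw] := eqVneq r w.
have tw : t != w by apply: contraNneq tD => ->.
have f'fix a : f a = a -> a != w -> f' a = a.
  by move=> fa aw; apply/eqP; rewrite -in_fixes Ef' !inE aw fa eqxx orbT.
apply: (addo f') => //; [exact: f'fix | | exact: f'fix | by rewrite cf'].
by apply/eqP; rewrite -in_fixes Ef' !inE eqxx.
Qed.

End Exposable.

(** * The barrier of a vertex outside D(G) *)

Section Cofree.
Variable G : sgraph.
Implicit Types (f g h : {ffun G -> G}) (T W X Y Z : {set G}) (a b s t u v x y z : G).

Notation D0 := (@exposable G set0).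
Notation d0 := (@dfc G set0).

(* For [s] outside D(G) this is D(G - s), and [border s] is A(G - s) with [s] added. *)
Definition cofree s := [set v | (v != s) &&
  [exists f : {ffun G -> G}, mating [set s; v] f && (#|fixes f| <= d0 + 2)]].

Definition border s := neighbours (cofree s).

Lemma cofreeP s v : reflect (v != s /\ exists f : {ffun G -> G},
    [/\ mating set0 f, f s = s, f v = v & #|fixes f| <= d0 + 2]) (v \in cofree s).
Proof.
rewrite inE; apply: (iffP andP) => -[vs].
  case/existsP=> f /andP[fm cf]; split=> //; exists f; split=> //.
  - exact: matingS (sub0set _) fm.
  - by apply: mating_fix fm _; rewrite !inE eqxx.
  - by apply: mating_fix fm _; rewrite !inE eqxx orbT.
case=> f [fm fs fv cf]; split=> //; apply/existsP; exists f; rewrite cf andbT.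
rewrite -[[set s; v]]setU0; apply: matingU => //.
by apply/subsetP=> z; rewrite !inE => /orP[] /eqP->; apply/eqP.
Qed.

(** The symmetry of [dm_forbid] comes from this one. *)
Lemma cofree_sym s t : (t \in cofree s) = (s \in cofree t).
Proof.
by apply/cofreeP/cofreeP=> -[st [f [fm fs ft cf]]]; split; rewrite 1?eq_sym //; exists f.
Qed.

Lemma cofree_irr s : s \notin cofree s.
Proof. by rewrite inE eqxx. Qed.

Lemma neighboursP X v :
  reflect (v \notin X /\ exists2 u, u \in X & edge u v) (v \in neighbours X).
Proof.
rewrite inE; apply: (iffP andP) => -[vX].
  by case/existsP=> u /andP[uX uv]; split=> //; exists u.
by case=> u uX uv; split=> //; apply/existsP; exists u; rewrite uX.
Qed.

Lemma neighbours_or X u v : u \in X -> edge u v -> v \in X \/ v \in neighbours X.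
Proof.
move=> uX uv; case: (boolP (v \in X)) => vX; [by left | right].
by apply/neighboursP; split=> //; exists u.
Qed.

Lemma optimal_notin f s : optimal set0 f -> s \notin D0 -> f s != s.
Proof. by move=> fo; apply: contra => /eqP fs; apply/exposableP; exists f. Qed.

(** By [dfcU1], the bound [d0 + 2] in [cofree] is optimality for [[set s]]. *)
Lemma cofreeU1 s : s \notin D0 -> s |: cofree s = exposable [set s].
Proof.
move=> sD; have dE : dfc [set s] = d0 + 2 by rewrite -(dfcU1 sD) setU0.
apply/setP=> v; rewrite in_setU1; have [->|vs] /= := eqVneq v s.
  by symmetry; apply: (subsetP (exposable_sub _)); rewrite inE.
apply/cofreeP/exposableP => [[_ [f [fm fs fv cf]]]|[f fo fv]].
  exists f => //; have fms : mating [set s] f.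
    rewrite -[[set s]]setU0; apply: matingU => //.
    by apply/subsetP=> z; rewrite !inE => /eqP->; apply/eqP.
  by rewrite /optimal fms eqn_leq dE cf -dE dfc_le.
split=> //; exists f; split=> //.
- exact: matingS (sub0set _) (optimal_mating fo).
- by apply: mating_fix (optimal_mating fo) _; rewrite inE.
- by rewrite (optimal_card fo) dE.
Qed.

Lemma exposable_cofree s : s \notin D0 -> D0 \subset cofree s.
Proof.
move=> sD; apply/subsetP=> v vD; have [f fo fv] := exposableP _ _ vD.
have vs : v != s by apply: contraNneq sD => <-.
have fm := optimal_mating fo; have fs := optimal_notin fo sD.
apply/cofreeP; split=> //; exists (rmv f s); split.
- exact: matingS (sub0set _) (rmv_mating s fm).
- by rewrite (rmvE _ _ fm) eqxx.
- by rewrite (rmvE _ _ fm) fv if_same.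
- by rewrite (card_rmv fm fs) (optimal_card fo).
Qed.

Lemma mate_cofree f s : optimal set0 f -> s \notin D0 -> f s \in cofree s.
Proof.
move=> fo sD; have fm := optimal_mating fo; have fs := optimal_notin fo sD.
apply/cofreeP; split=> //; exists (rmv f s); split.
- exact: matingS (sub0set _) (rmv_mating s fm).
- by rewrite (rmvE _ _ fm) eqxx.
- by rewrite (rmvE _ _ fm) eqxx orbT.
- by rewrite (card_rmv fm fs) (optimal_card fo).
Qed.

Lemma mate_edge f s : optimal set0 f -> s \notin D0 -> edge (f s) s.
Proof.
by move=> fo sD; rewrite edge_sym (mating_edge (optimal_mating fo)) // optimal_notin.
Qed.

Lemma border_self s : s \notin D0 -> s \in border s.
Proof.
move=> sD; have [f fo] := optimal_ex (set0 : {set G}).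
apply/neighboursP; split; first exact: cofree_irr.
by exists (f s); [exact: mate_cofree | exact: mate_edge].
Qed.

Lemma border_notin s t : t \in border s -> t \notin cofree s.
Proof. by case/neighboursP. Qed.

Lemma border_exposable s t : s \notin D0 -> t \in border s -> t \notin D0.
Proof.
move=> sD /border_notin; apply: contra; exact: (subsetP (exposable_cofree sD)).
Qed.

(** Stability is applied once for each vertex of [T] other than [s]: it is adjacent to [cofree s],
    which persists in the exposable set, so it raises [dfc] by two. *)
Lemma border_subset s T : s \notin D0 -> s \in T -> T \subset border s ->
  dfc T = d0 + 2 * #|T| /\ exposable T = T :|: cofree s.
Proof.
move=> sD; have [n] := ubnP #|T|; elim: n T => // n IHn T ltn sT TB.
have [T1|[t]] := set_0Vmem (T :\ s).
  have -> : T = [set s] by rewrite -(setD1K sT) T1 setU0.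
  by rewrite cards1 muln1 cofreeU1 // -(dfcU1 sD) setU0.
rewrite !inE => /andP[ts tT].
have cT := cardsD1 t T; rewrite tT in cT.
have [||| dT DT] := IHn (T :\ t); first by lia.
- by rewrite !inE eq_sym ts.
- exact: subset_trans (subsetDl _ _) TB.
have tB : t \in border s := subsetP TB _ tT.
have tD : t \notin exposable (T :\ t) by rewrite DT !inE eqxx /=; have := border_notin tB; rewrite inE.
have [_ [y yE yt]] := neighboursP _ _ tB.
rewrite -(setD1K tT) dfcU1 // (@stability _ _ _ y) //.
- by split; [rewrite dT setD1K // cT /=; lia | rewrite DT setUA].
- by rewrite DT inE yE orbT.
- by apply/negP=> yT; have := border_notin (subsetP TB _ (subsetP (subsetDl _ _) _ yT)); rewrite yE.
- by rewrite edge_sym.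
Qed.

(** Exposing the whole barrier leaves at least [d0 + 2 * #|border s|] exposed vertices, and the
    barrier vertices that [g] already exposes add nothing when this is done to [g]. *)
Lemma tight_le s g : s \notin D0 -> mating set0 g ->
  d0 + 2 * #|fixes g :&: border s| <= #|fixes g|.
Proof.
move=> sD gm; have [dB _] := border_subset sD (border_self sD) (subxx _).
have := card_unmatch (border s) gm.
have := dfc_le (unmatch_mating (border s) gm); rewrite setU0 dB.
lia.
Qed.

(* Both [x] and [y] lie in one factor-critical component of [cofree s]; a
   matching that is optimal relative to the barrier [border s] leaves only one
   vertex of it to be missed or matched to the barrier. *)
Lemma tight_eq s g x y : s \notin D0 -> mating set0 g ->
  #|fixes g| <= d0 + 2 * #|fixes g :&: border s| ->
  connect (within (cofree s)) x y -> x != y -> 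
  (g x == x) || (g x \in border s) -> (g y == y) || (g y \in border s) -> False.
Proof.
move=> sD gm cg xy xNy gx gy.
have [dB DB] := border_subset sD (border_self sD) (subxx _).
have um := unmatch_mating (border s) gm; rewrite setU0 in um.
(* Equality in the barrier count makes this mating optimal, so that Gallai's lemma applies to it. *)
have uo : optimal (border s) (unmatch g (border s)).
  rewrite /optimal um eqn_leq dfc_le // andbT dB.
  by have := card_unmatch (border s) gm; lia.
have DBE : exposable (border s) :\: border s = cofree s.
  apply/setP=> z; rewrite DB in_setD in_setU.
  by case: (boolP (z \in border s)) => //= /border_notin /negPf.
apply: (gallai _ xNy uo); first by rewrite DBE.
  by rewrite ffunE; case: ifP => // /norP[_ /negPf h]; move: gx; rewrite h orbF => /eqP.
by rewrite ffunE; case: ifP => // /norP[_ /negPf h]; move: gy; rewrite h orbF => /eqP.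
Qed.

(** A witness for [r \in cofree t] cannot expose [s], as [t] is outside [cofree s]. Breaking its
    edge at [s] makes it optimal for [[set s; t]], whose exposable set is known from
    [border_subset]. *)
Lemma border_cofree_sub s t : s \notin D0 -> t \in border s -> cofree t \subset cofree s.
Proof.
move=> sD tB; have tD := border_exposable sD tB.
have [//|ts] := eqVneq t s; first by move=> ->.
have [||dB DB] := @border_subset s [set s; t] sD; first by rewrite !inE eqxx.
  by apply/subsetP=> z /set2P[] ->; rewrite ?border_self.
apply/subsetP=> r /cofreeP[rt [f [fm ft fr cf]]].
have [rs|rs] := eqVneq r s.
  have := border_notin tB; rewrite cofree_sym -rs; case/negP.
  by apply/cofreeP; split=> //; exists f.
have : r \in exposable [set s; t].
  have fs : f s != s.
    apply/eqP=> fs; have := border_notin tB; case/negP.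
    by apply/cofreeP; split=> //; exists f.
  apply/exposableP; exists (rmv f s); last by rewrite (rmvE _ _ fm) fr if_same.
  have um : mating [set s; t] (rmv f s).
    rewrite -[[set s; t]]setU0; apply: matingU (matingS (sub0set _) (rmv_mating s fm)) _.
    apply/subsetP=> z; rewrite !inE => /orP[] /eqP->; rewrite (rmvE _ _ fm) ?eqxx //.
    by rewrite ft if_same.
  rewrite /optimal um eqn_leq dfc_le // andbT dB (card_rmv fm fs) cards2 eq_sym ts.
  by lia.
by rewrite DB !inE (negPf rs) (negPf rt).
Qed.

(** The mate of [t] in an optimal mating is a neighbour of [t] in [cofree t]; and [t \in cofree s]
    would put [s] into [cofree t], hence into [cofree s]. *)
Lemma cofree_sub_border s t : t \notin D0 -> cofree t \subset cofree s -> t \in border s.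
Proof.
move=> tD sub; have [f fo] := optimal_ex (set0 : {set G}).
apply/neighboursP; split; last first.
  by exists (f t); [apply: (subsetP sub); exact: mate_cofree | exact: mate_edge].
apply/negP; rewrite cofree_sym => /(subsetP sub); apply/negP; exact: cofree_irr.
Qed.

Lemma border_sub s t : s \notin D0 -> t \in border s -> border t \subset border s.
Proof.
move=> sD tB; have tD := border_exposable sD tB; apply/subsetP=> b bB.
apply: cofree_sub_border; first exact: border_exposable tD bB.
by apply: subset_trans (border_cofree_sub tD bB) (border_cofree_sub sD tB).
Qed.

(** Stability for T empty: deleting a vertex of A(G) does not change D(G). *)
Lemma barrier_cofree a : a \in neighbours D0 -> cofree a = D0.
Proof.
case/neighboursP=> aD [y yD ya].
have E : exposable [set a] = a |: D0.
  by have := @stability _ set0 a y aD yD; rewrite setU0 in_set0 edge_sym => ->.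
rewrite -cofreeU1 // in E.
by rewrite -(setU1K (cofree_irr a)) E setU1K.
Qed.

Lemma barrier_border s : s \notin D0 -> neighbours D0 \subset border s.
Proof.
move=> sD; apply/subsetP=> a aA; apply: cofree_sub_border.
  by case/neighboursP: aA.
by rewrite barrier_cofree // exposable_cofree.
Qed.

Lemma mating_neighbours X f : mating set0 f ->
  forall x, x \in X -> f x \in X :|: neighbours X.
Proof.
move=> fm x xX; rewrite inE; case: (f x =P x) => [->|/eqP /(mating_edge fm)]; first by rewrite xX.
by case/(neighbours_or xX) => ->; rewrite ?orbT.
Qed.

(* Otherwise, the witness for [v \in cofree s :\: Y] inside [Y :|: W] together with
   [f] outside it would violate [tight_le]. *)
Lemma cofree_closure f s Y W : optimal set0 f -> s \notin D0 ->
  Y \subset cofree s -> W \subset border s -> s \in W -> D0 \subset Y ->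
  neighbours Y \subset W -> (forall x, x \in W -> f x \in Y) -> cofree s \subset Y.
Proof.
move=> fo sD /subsetP YE /subsetP WB sW /subsetP DY NY fW.
have fm := optimal_mating fo; have fK := mating_inv fm.
apply/subsetP=> v vE; apply/negPn/negP=> vY.
have vW : v \notin W by apply/negP=> /WB /border_notin; rewrite vE.
have [vs [g [gm gs gv cg]]] := cofreeP _ _ vE.
have gK := mating_inv gm.
set X := Y :|: W.
have Xc h : mating set0 h -> forall x, x \in Y -> h x \in X.
  move=> hm x /(mating_neighbours hm); rewrite !in_setU => /orP[->//|].
  by move/(subsetP NY)=> ->; rewrite orbT.
have fX x : (f x \in X) = (x \in X).
  have imp z : z \in X -> f z \in X.
    by rewrite {1}inE => /orP[/(Xc f fm)//|/fW h]; rewrite inE h.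
  by apply/idP/idP=> /imp; rewrite ?fK.
(* [X] is stable under [f], so [k] may follow [g] inside [X], dropping the edges of [g] that leave
   [X], and [f] outside. *)
pose k : {ffun G -> G} := [ffun x => if x \in X then (if g x \in X then g x else x) else f x].
have km : mating set0 k.
  apply/matingP; split=> [x|x|x]; last by rewrite inE.
    rewrite !ffunE; case: (boolP (x \in X)) => xX; last by rewrite fX (negPf xX) fK.
    by case: (boolP (g x \in X)) => gx; rewrite ?gx ?gK ?xX ?(negPf gx) //.
  rewrite ffunE; case: ifP => _; last exact: mating_edge fm.
  by case: ifP => _; [exact: mating_edge gm | rewrite eqxx].
(* Only vertices of [W] can lose their mate, since [g] maps [Y] into [X]; outside [X] nothing is
   exposed because D(G) lies in [Y]. *)
set N := [set x in W | g x \notin X].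
have kfix : fixes k \subset (fixes g :\ v) :|: N.
  apply/subsetP=> x; rewrite !inE ffunE; case: (boolP (x \in X)) => xX.
    have xv : x != v by apply: contraTneq xX => ->; rewrite inE (negPf vY).
    case: ifP => [_ ->|gx _]; rewrite ?xv //=; apply/orP; right.
    move: gx; rewrite -in_setU => /negbT gx; rewrite gx andbT.
    by move: xX; rewrite inE => /orP[/(Xc g gm)|//]; rewrite (negPf gx).
  move=> /eqP fx; case/negP: xX; rewrite inE; apply/orP; left; apply: DY.
  by apply/exposableP; exists f.
have ck : #|fixes k| <= #|fixes g :\ v| + #|N|.
  apply: leq_trans (subset_leq_card kfix) _.
  exact: leq_of_leqif (leq_card_setU _ _).
have sX : s \in X by rewrite inE sW orbT.
have sN : s \notin N by rewrite inE gs sX andbF.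
(* [s] and [N] are barrier vertices exposed by [k], so [tight_le] demands [d0 + 2 * #|N| + 2]
   exposed vertices; the count above allows [d0 + 1 + #|N|], as [v] is no longer counted. *)
have sub : s |: N \subset fixes k :&: border s.
  apply/subsetP=> x; rewrite in_setU1 => /orP[/eqP->|].
    by rewrite in_setI in_fixes ffunE gs sX eqxx border_self.
  rewrite inE => /andP[xW gx]; rewrite in_setI WB // andbT inE ffunE (negPf gx).
  by rewrite inE xW orbT.
have := subset_leq_card sub; rewrite cardsU1 sN.
have := tight_le sD km.
have cgv := cardsD1 v (fixes g); rewrite inE gv eqxx in cgv.
by move: cgv ck cg; clear; lia.
Qed.

End Cofree.

(** * Matchings as sets of edges; induced subgraphs and contractions *)

Section Bridge.
Variable G : sgraph.
Implicit Types (f g h : {ffun G -> G}) (M : {set {set G}}) (T W X Y Z : {set G})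
  (a b s t u v x y z : G).

Notation D0 := (@exposable G set0).
Notation d0 := (@dfc G set0).

Lemma edgesP X :
  reflect (exists x y, edge x y /\ X = [set x; y]) (X \in edges G).
Proof.
apply: (iffP imsetP) => [[[x y] /= exy ->]|[x [y [exy ->]]]]; last by exists (x, y); rewrite ?inE.
by exists x, y; rewrite inE in exy.
Qed.

Lemma edges_pair x y : [set x; y] \in edges G -> edge x y.
Proof.
case/edgesP=> a [b [ab E]]; have abN := edge_neq ab.
have : a \in [set x; y] by rewrite E !inE eqxx.
have : b \in [set x; y] by rewrite E !inE eqxx orbT.
rewrite !inE => /orP[] /eqP bE /orP[] /eqP aE; subst; rewrite ?ab ?eqxx // in abN *.
by rewrite edge_sym.
Qed.

Lemma card_cover_matching M : matching M -> #|cover M| = 2 * #|M|.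
Proof.
case/andP=> /subsetP ME /eqP <-.
rewrite mulnC -sum_nat_const; apply: eq_bigr => X.
by move=> /ME /edgesP[x [y [/edge_neq xy ->]]]; rewrite cards2 xy.
Qed.

Lemma matching_eq M X Y x : matching M -> X \in M -> Y \in M -> x \in X -> x \in Y ->
  X = Y.
Proof.
case/andP=> _ /trivIsetP tM XM YM xX xY; apply/eqP/negPn/negP=> XY.
by have /pred0P/(_ x) := tM _ _ XM YM XY; rewrite /= xX xY.
Qed.

Lemma set2_inj x y z : [set x; y] = [set x; z] -> y = z.
Proof.
move=> E; have : y \in [set x; z] by rewrite -E !inE eqxx orbT.
have : z \in [set x; y] by rewrite E !inE eqxx orbT.
by rewrite !inE => /orP[] /eqP zE /orP[] /eqP yE; subst.
Qed.

Lemma mating_of_matching M : matching M ->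
  exists f, [/\ mating set0 f, fixes f = ~: cover M
              & forall u v, [set u; v] \in M -> f u = v].
Proof.
move=> Mm; have /andP[/subsetP ME _] := Mm.
(* The default [x] makes the uncovered vertices fixed points. *)
pose f := [ffun x => odflt x [pick y | [set x; y] \in M]].
have fM u v : [set u; v] \in M -> f u = v.
  move=> uv; rewrite ffunE; case: pickP => [y uy|/(_ v)]; last by rewrite uv.
  by apply: (@set2_inj u); apply: (matching_eq (x := u) Mm); rewrite // !inE eqxx.
have cov x : x \in cover M -> [set x; f x] \in M.
  case/bigcupP=> X XM xX; have [a [b [ab XE]]] := edgesP _ (ME _ XM).
  move: xX XM; rewrite XE !inE => /orP[] /eqP->; first by move=> h; rewrite (fM _ _ h).
  by rewrite setUC => h; rewrite (fM _ _ h).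
have ncov x : x \notin cover M -> f x = x.
  move=> xM; rewrite ffunE; case: pickP => // y xy; case/negP: xM.
  by apply/bigcupP; exists [set x; y]; rewrite // !inE eqxx.
exists f; split=> //.
  apply/matingP; split=> [x|x|x]; last by rewrite inE.
    case: (boolP (x \in cover M)) => [/cov xM|/ncov xM]; last by rewrite !xM.
    by apply: fM; rewrite setUC.
  case: (boolP (x \in cover M)) => [/cov /ME /edges_pair //|/ncov->]; by rewrite eqxx.
apply/setP=> x; rewrite !inE; case: (boolP (x \in cover M)) => [/cov /ME /edges_pair|/ncov->].
  by move/edge_neq; rewrite eq_sym => /negPf.
exact: eqxx.
Qed.

Lemma matching_of_mating f : mating set0 f ->
  exists M, [/\ matching M, cover M = ~: fixes f
              & forall u, f u != u -> [set u; f u] \in M].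
Proof.
move=> fm; have fK := mating_inv fm.
exists [set [set u; f u] | u in ~: fixes f]; split; last first.
- by move=> u fu; apply/imsetP; exists u; rewrite // !inE.
- apply/setP=> x; apply/bigcupP/idP => [[X /imsetP[u]]|xf].
    rewrite !inE => fu -> /set2P[] -> //.
    by rewrite fK eq_sym.
  by exists [set x; f x]; [apply: imset_f | rewrite !inE eqxx].
apply/andP; split.
  apply/subsetP=> X /imsetP[u]; rewrite !inE => fu ->.
  by apply/edgesP; exists u, (f u); split=> //; apply: mating_edge fm fu.
apply/trivIsetP=> A B /imsetP[u _ ->] /imsetP[v _ ->] uv.
apply/pred0P=> x /=; apply/negbTE; apply: contra uv => /andP[/set2P[] -> /set2P[]].
- by move->.
- by move->; rewrite fK setUC.
- by move=> <-; rewrite fK setUC.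
- by move/(can_inj fK)->.
Qed.

Lemma nu_dfc : #|G| = d0 + 2 * nu G.
Proof.
have leM M : matching M -> d0 + 2 * #|M| <= #|G|.
  move=> Mm; have [f [fm fE _]] := mating_of_matching Mm.
  have := dfc_le fm; rewrite fE -(card_cover_matching Mm) => h.
  by have : #|cover M| + #|~: cover M| = #|G| := cardsC _; lia.
apply/eqP; rewrite eqn_leq; apply/andP; split.
  have [f fo] := optimal_ex (set0 : {set G}).
  have [M [Mm cM _]] := matching_of_mating (optimal_mating fo).
  have : #|M| <= nu G by apply: (@leq_bigmax_cond _ (@matching G) (fun M => #|M|)).
  have := card_cover_matching Mm; rewrite cM.
  by have : #|fixes f| + #|~: fixes f| = #|G| := cardsC _; rewrite (optimal_card fo); lia.
have m0 : matching (set0 : {set {set G}}).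
  rewrite /matching sub0set; apply/trivIsetP=> A B; by rewrite inE.
have [|M Mm nuE] := @eq_bigmax_cond _ (@matching G) (fun M : {set {set G}} => #|M|).
  by apply/card_gt0P; exists set0.
by rewrite (_ : nu G = #|M|); [exact: leM | exact: nuE].
Qed.

Lemma deficiencyE : deficiency G = d0.
Proof. by rewrite /deficiency nu_dfc addnK. Qed.

Lemma max_matchingE M f : matching M -> mating set0 f -> fixes f = ~: cover M ->
  max_matching M = optimal set0 f.
Proof.
move=> Mm fm fE; rewrite /max_matching /optimal Mm fm /= fE.
rewrite -(eqn_pmul2l (isT : 0 < 2)) -(card_cover_matching Mm).
have h0 : #|cover M| + #|~: cover M| = #|G| := cardsC _.
have h1 := nu_dfc.
by apply/eqP/eqP; lia.
Qed.

Lemma DsetE : Dset G = D0.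
Proof.
apply/setP=> v; apply/idP/exposableP; rewrite inE.
  case/existsP=> M /andP[Mmax vM]; have Mm : matching M by case/andP: Mmax.
  have [f [fm fE _]] := mating_of_matching Mm.
  exists f; first by rewrite -(max_matchingE Mm).
  by apply/eqP; rewrite -in_fixes fE inE.
case=> f fo fv; have fm := optimal_mating fo.
have [M [Mm cM _]] := matching_of_mating fm.
have fE : fixes f = ~: cover M by rewrite cM setCK.
apply/existsP; exists M; rewrite (max_matchingE Mm fm fE) fo /= cM !inE negbK.
exact/eqP.
Qed.

Lemma allowedP u v :
  reflect (edge u v /\ exists2 f, optimal set0 f & f u = v) (allowed u v).
Proof.
apply: (iffP andP) => -[euv]; split=> //.
  case/existsP: (b) => M /andP[Mmax uvM]; have Mm : matching M by case/andP: Mmax.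
  have [f [fm fE fM]] := mating_of_matching Mm.
  by exists f; [rewrite -(max_matchingE Mm) | apply: fM].
case: b => f fo fu; have fm := optimal_mating fo.
have [M [Mm cM Mf]] := matching_of_mating fm.
have fE : fixes f = ~: cover M by rewrite cM setCK.
apply/existsP; exists M; rewrite (max_matchingE Mm fm fE) fo /= -fu Mf //.
by rewrite fu eq_sym edge_neq.
Qed.

Lemma perfectP : reflect (exists f, mating set0 f /\ fixes f = set0)
  (has_perfect_matching G).
Proof.
apply: (iffP existsP) => [[M /andP[Mm /eqP cM]]|[f [fm f0]]].
  have [f [fm fE _]] := mating_of_matching Mm; exists f; split=> //.
  by rewrite fE cM setCT.
have [M [Mm cM _]] := matching_of_mating fm.
by exists M; rewrite /perfect_matching Mm cM f0 setC0 eqxx.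
Qed.

End Bridge.

(** * Transport of matings along an isomorphism onto an induced subgraph *)

Section Transport.
Variables (G1 G2 : sgraph) (phi : G1 -> G2) (psi : G2 -> option G1).
Hypothesis psiK : pcancel phi psi.
Hypothesis phiK : ocancel psi phi.
Hypothesis edge_phi : forall x y, edge (phi x) (phi y) = edge x y.

Definition push (f : {ffun G1 -> G1}) : {ffun G2 -> G2} :=
  [ffun z => if psi z is Some x then phi (f x) else z].

(* Edges leaving the image of [phi] are dropped. *)
Definition pull (f : {ffun G2 -> G2}) : {ffun G1 -> G1} :=
  [ffun x => odflt x (psi (f (phi x)))].

Lemma push_phi f x : push f (phi x) = phi (f x).
Proof. by rewrite ffunE psiK. Qed.

Lemma psiP z : {x | z = phi x} + (psi z = None).
Proof.
have := phiK z; case: (psi z) => [x /= <-|_]; [left; by exists x | by right].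
Qed.

Lemma push_mating f : mating set0 f -> mating set0 (push f).
Proof.
case/matingP=> fK fe _; apply/matingP; split=> [z|z|z]; last by rewrite inE.
  case: (psiP z) => [[x ->]|zN]; first by rewrite !push_phi fK.
  by rewrite !ffunE !zN.
case: (psiP z) => [[x ->]|zN]; last by rewrite !ffunE !zN eqxx.
rewrite push_phi edge_phi => h; apply: fe; by apply: contra h => /eqP->.
Qed.

Lemma fixes_push f : fixes (push f) = ~: (phi @: ~: fixes f).
Proof.
have inj := pcan_inj psiK.
apply/setP=> z; rewrite !inE; case: (psiP z) => [[x ->]|zN].
  by rewrite push_phi mem_imset // !inE negbK (inj_eq inj).
rewrite ffunE zN eqxx; symmetry; apply/imsetP=> -[x _ zx].
by rewrite zx psiK in zN.
Qed.

Lemma pull_mating f : mating set0 f -> mating set0 (pull f).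
Proof.
case/matingP=> fK fe _; apply/matingP; split=> [x|x|x]; last by rewrite inE.
  rewrite !ffunE; have := phiK (f (phi x)); case E: (psi _) => [y|] /=.
    by move=> yE; rewrite -yE in E *; rewrite yE fK psiK.
  by rewrite E.
rewrite !ffunE; have := phiK (f (phi x)); case E: (psi _) => [y|] /=; last by rewrite eqxx.
move=> yE yx; rewrite -edge_phi yE; apply: fe; rewrite -yE.
by apply: contra yx => /eqP /(pcan_inj psiK)->.
Qed.

Lemma in_fixes_pull (f : {ffun G2 -> G2}) x : (x \in fixes (pull f)) =
  (f (phi x) == phi x) || (psi (f (phi x)) == None).
Proof.
rewrite inE ffunE; have := phiK (f (phi x)); case: (psi _) => [y|] /=.
  by move<-; rewrite (inj_eq (pcan_inj psiK)) orbF.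
by rewrite eqxx orbT.
Qed.

End Transport.

(** * Matings and deficiency of an induced subgraph *)

Section InducedTransport.
Variables (G : sgraph) (X : {set G}).
Implicit Types (f g h : {ffun G -> G}) (T W Y Z : {set G}) (a b s t u v x y z : G).

Let phi (x : induced X) : G := val x.
Let psi (z : G) : option (induced X) := insub z.
Let psiK : pcancel phi psi := valK.
Let phiK : ocancel psi phi := @insubK _ _ _.
Let edge_phi (x y : induced X) : edge (phi x) (phi y) = edge x y := erefl.

Lemma push_induced (f : {ffun induced X -> induced X}) : mating set0 f ->
  exists g, mating (~: X) g /\ fixes g = ~: (val @: ~: fixes f).
Proof.
move=> fm; exists (push phi psi f); have fE := fixes_push psiK phiK f.
split; last by rewrite fE.
rewrite -[~: X]setU0; apply: matingU (push_mating psiK phiK edge_phi fm) _.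
rewrite fE setCS; apply/subsetP=> z /imsetP[x _ ->]; exact: valP.
Qed.

Lemma pull_induced g : mating set0 g ->
  exists f : {ffun induced X -> induced X}, mating set0 f /\
    fixes f = [set x | (g (val x) == val x) || (g (val x) \notin X)].
Proof.
move=> gm; exists (pull phi psi g); split; first exact: pull_mating psiK phiK edge_phi _ gm.
apply/setP=> x; rewrite in_fixes_pull // inE; congr orb.
rewrite /psi; case: insubP => [y -> _|/negPf->] //.
Qed.

Lemma card_induced : #|induced X| = #|X|.
Proof. by rewrite card_sig; apply: eq_card. Qed.

(** This justifies reading [dfc T] as the deficiency of G - T plus [#|T|], with [T] the complement
    of [X]. *)
Lemma induced_deficiency : deficiency (induced X) + #|~: X| = dfc (~: X).
Proof.
rewrite deficiencyE.
have cX : #|X| + #|~: X| = #|G| := cardsC _.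
apply/eqP; rewrite eqn_leq; apply/andP; split.
  have [g go] := optimal_ex (~: X).
  have [f [fm fE]] := pull_induced (matingS (sub0set _) (optimal_mating go)).
  have sub : fixes g \subset ~: X :|: val @: fixes f.
    apply/subsetP=> z; rewrite !inE; case: (boolP (z \in X)) => //= zX gz.
    by apply/imsetP; exists (exist _ z zX); rewrite // fE inE gz.
  have le1 := dfc_le fm; have cg := optimal_card go.
  have E : fixes g = ~: X :|: val @: fixes f.
    apply/eqP; rewrite eqEsubset sub; apply/subsetP=> z /setUP[zX|/imsetP[x xf ->]].
      by rewrite inE (mating_fix (optimal_mating go)).
    move: xf; rewrite fE !inE => /orP[//|gx]; apply/eqP.
    have gm := optimal_mating go.
    have := @mating_fix _ _ _ (g (val x)) gm; rewrite inE gx (mating_inv gm) => <- //.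
  rewrite -cg E cardsU.
  rewrite (_ : _ :&: _ = set0) ?cards0 ?subn0; last first.
    by apply/setP=> z; rewrite !inE; apply/negP=> /andP[zX /imsetP[x _ zx]]; rewrite zx (valP x) in zX.
  rewrite card_imset; last exact: val_inj.
  by rewrite addnC leq_add2l.
have [f fo] := optimal_ex (set0 : {set induced X}).
have [g [gm gE]] := push_induced (optimal_mating fo).
have := dfc_le gm; rewrite gE; rewrite -(optimal_card fo).
have c1 : #|fixes f| + #|~: fixes f| = #|X| by rewrite -card_induced; apply: cardsC.
have c2 : #|val @: (~: fixes f)| + #|~: (val @: (~: fixes f))| = #|G| := cardsC _.
have c3 : #|val @: (~: fixes f)| = #|~: fixes f| by rewrite card_imset //; exact: val_inj.
by move: c1 c2 c3 cX; clear; lia.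
Qed.

Lemma induced_perfectP :
  reflect (exists g, mating (~: X) g /\ fixes g = ~: X) (has_perfect_matching (induced X)).
Proof.
apply: (iffP (perfectP _)) => [[f [fm fE]]|[g [gm gE]]].
  have [g [gm gE]] := push_induced fm; exists g; split=> //.
  rewrite gE fE setC0; congr (~: _); apply/setP=> z; apply/imsetP/idP => [[x _ ->]|zX].
    exact: valP.
  by exists (exist _ z zX).
have [f [fm fE]] := pull_induced (matingS (sub0set _) gm).
exists f; split=> //; rewrite fE; apply/setP=> x; rewrite !inE.
have gx z : (g z == z) = (z \notin X) by rewrite -in_fixes gE inE.
have := mating_out gm (x := val x).
by rewrite gx (valP x) !inE !negbK => /(_ (valP x))->.
Qed.

End InducedTransport.

(** * Factor-criticality of a contraction in terms of matings of G *)

Section ContractTransport.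
Variables (G : sgraph) (X H : {set G}).
Hypothesis HX : H \subset X.
Implicit Types (f g p : {ffun G -> G}) (u x h : G).

Let H' := [set x : induced X | val x \in H].
Let Q := contract H'.
Let I := induced (X :\: H).

Let inX (x : I) : val x \in X. Proof. by have := valP x; rewrite inE => /andP[]. Qed.
Let notH' (x : I) : exist _ (val x) (inX x) \notin H'.
Proof. by rewrite inE; have := valP x; rewrite inE => /andP[]. Qed.

Let phi (x : I) : Q := Some (exist _ (exist _ (val x) (inX x)) (notH' x)).
Let psi (w : Q) : option I := obind (fun y : {x : induced X | x \notin H'} => insub (val (val y))) w.

Let psiK : pcancel phi psi.
Proof. by move=> x; rewrite /psi /= valK. Qed.

Let psi_some (y : {x : induced X | x \notin H'}) : {x | psi (Some y) = Some x & phi x = Some y}.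
Proof.
rewrite /psi /=; case: insubP => [x _ xE|].
  by exists x => //; congr Some; apply: val_inj; apply: val_inj.
by rewrite inE (valP (val y)) andbT negbK => h; have := valP y; rewrite inE h.
Qed.

Let phiK : ocancel psi phi.
Proof. by move=> [y|] //=; have [x] := psi_some y; rewrite /psi /= => ->. Qed.

Let edge_phi (x y : I) : edge (phi x) (phi y) = edge x y. Proof. by []. Qed.

Let edge_None (x : I) : edge (None : Q) (phi x) -> exists2 h, h \in H & edge (val x) h.
Proof.
by case/existsP=> u /andP[]; rewrite inE edge_sym => uH ux; exists (val u).
Qed.

Let edge_NoneI (x : I) h : h \in H -> edge (val x) h -> edge (None : Q) (phi x).
Proof.
move=> hH xh; apply/existsP; exists (exist _ h (subsetP HX _ hH)).
by rewrite inE hH edge_sym.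
Qed.

(** Deleting the contracted vertex leaves a perfect matching of [X :\: H]. Deleting [x] leaves one
    in which the contracted vertex has a mate [u]; that edge lifts to some [u h] with [h] in [H],
    and the rest misses [x] and [u]. *)
Lemma contract_criticalP :
  reflect ((exists p, mating (~: (X :\: H)) p /\ fixes p = ~: (X :\: H)) /\
     forall x, x \in X :\: H -> exists u h p,
        [/\ u \in X :\: H, u != x, h \in H, edge u h & 
            mating (~: (X :\: H)) p /\ fixes p = ~: (X :\: H) :|: [set x; u]])
   (factor_critical (contract [set x : induced X | val x \in H])).
Proof.
apply: (iffP forallP) => [fc|[[p [pm pE]] fc] w].
  split=> [|x xXH].
    have /induced_perfectP[q [qm qE]] := fc None.
    rewrite setCK in qm qE.
    have q0 := matingS (sub0set _) qm.
    have qN : q None = None by apply: (mating_fix qm); rewrite inE.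
    have pm := pull_mating psiK phiK edge_phi q0.
    have pE : fixes (pull phi psi q) = set0.
      apply/setP=> x; rewrite in_fixes_pull // -in_fixes qE !inE /=.
      have := mating_inv qm (phi x); case E: (q (phi x)) => [y|].
        by have [x' -> _] := psi_some y.
      by rewrite qN.
    have [g [gm gE]] := push_induced pm; exists g; split=> //.
    rewrite gE pE setC0; congr (~: _).
    apply/setP=> z; apply/imsetP/idP => [[y _ ->]|zX]; first exact: (valP y).
    by exists (exist _ z zX).
  pose x' : I := exist _ x xXH.
  have /induced_perfectP[q [qm qE]] := fc (phi x').
  rewrite setCK in qm qE.
  have q0 := matingS (sub0set _) qm.
  have qf z : (q z == z) = (z == phi x') by rewrite -in_fixes qE inE.
  have qN : q None != None by rewrite qf.
  case E: (q None) qN => [y|//] _.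
  have [u' _ uE] := psi_some y.
  have eNu : edge (None : Q) (phi u').
    by rewrite uE -E; apply: mating_edge q0 _; rewrite qf.
  have [h hH uh] := edge_None eNu.
  have qu : q (phi u') = None by rewrite uE -E (mating_inv q0).
  have pm := pull_mating psiK phiK edge_phi q0.
  have pE : fixes (pull phi psi q) = [set x'; u'].
    apply/setP=> z; rewrite in_fixes_pull // qf (inj_eq (pcan_inj psiK)) !inE; congr orb.
    case F: (q (phi z)) => [y0|] /=.
      have [z' zE _] := psi_some y0; rewrite /psi /= in zE; rewrite zE; symmetry; apply/negP=> /eqP zu.
      by rewrite zu qu in F.
    rewrite eqxx; symmetry; apply/eqP; apply: (pcan_inj psiK); apply: (can_inj (mating_inv q0)).
    by rewrite F qu.
  have [g [gm gE]] := push_induced pm; exists (val u'), h, g; split=> //.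
  - exact: valP.
  - apply/eqP=> ux; have ux' : u' = x' by apply: val_inj.
    have : q (phi u') == phi u' by rewrite qf ux'.
    by rewrite qu.
  split=> //; rewrite gE pE; apply/setP=> z; rewrite !inE -in_setD.
  case: (boolP (z \in X :\: H)) => zX /=.
    have -> : z = val (exist _ z zX : I) by [].
    rewrite mem_imset ?inE; last exact: val_inj.
    by rewrite negbK.
  by apply/imsetP=> -[z' _ zE]; rewrite zE (valP z') in zX.
case: w => [y|]; apply/induced_perfectP; rewrite setCK.
  have [x0 _ xE] := psi_some y.
  have [u [h [p' [uX ux hH uh [pm' pE']]]]] := fc _ (valP x0).
  have [f [fm fE]] := @pull_induced _ (X :\: H) _ (matingS (sub0set _) pm').
  have qm := push_mating psiK phiK edge_phi fm.
  have qE := fixes_push psiK phiK f.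
  pose u' : I := exist _ u uX.
  have fE2 : fixes f = [set x0; u'].
    have pf z : (p' z == z) = (z \in ~: (X :\: H) :|: [set val x0; u]) by rewrite -in_fixes pE'.
    apply/setP=> z; rewrite fE [LHS]inE.
    have -> : (p' (val z) \notin X :\: H) = false.
      by rewrite -in_setC; apply/negbTE/(mating_out pm'); rewrite in_setC negbK (valP z).
    by rewrite orbF pf in_setU in_setC (valP z) !inE -!val_eqE.
  have eN := @edge_NoneI u' _ hH uh.
  set q := push phi psi f in qm qE.
  have qfix w : (q w == w) = (w \notin phi @: ~: [set x0; u']) by rewrite -in_fixes qE inE fE2.
  have qN : q None = None.
    by apply/eqP; rewrite qfix; apply/imsetP=> -[].
  have qu : q (phi u') = phi u'.
    apply/eqP; rewrite qfix mem_imset; last exact: pcan_inj psiK.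
    by rewrite !inE eqxx orbT.
  (* The contracted vertex is exposed by [q]; it is joined to [u'] through the edge [u h]. *)
  exists (add q None (phi u')).
  have aE : fixes (add q None (phi u')) = [set phi x0].
    rewrite fixes_add //; apply/setP=> w; rewrite !inE qfix.
    case: w => [y1|]; last by rewrite eqxx andbF.
    have [z _ <-] := psi_some y1.
    rewrite !(inj_eq (pcan_inj psiK)) mem_imset; last exact: pcan_inj psiK.
    rewrite !inE negbK; have [->|zu] := eqVneq z u'; last by rewrite orbF.
    by symmetry; apply/negP=> /eqP zx; case/eqP: ux; rewrite -zx.
  split; last by rewrite aE xE.
  rewrite -xE -[[set phi x0]]setU0; apply: matingU; last by rewrite aE.
  by apply: add_mating; rewrite ?inE.
have [f [fm fE]] := @pull_induced _ (X :\: H) _ (matingS (sub0set _) pm).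
have qm := push_mating psiK phiK edge_phi fm.
have qE := fixes_push psiK phiK f.
have pf z : (p z == z) = (z \notin X :\: H) by rewrite -in_fixes pE in_setC.
have f0 : fixes f = set0.
  apply/setP=> z; rewrite fE in_set in_set0 pf (valP z) /= -in_setC.
  by apply/negbTE/(mating_out pm); rewrite in_setC negbK (valP z).
have E : fixes (push phi psi f) = [set None].
  rewrite qE f0 setC0; apply/setP=> w; rewrite in_setC in_set1.
  case: w => [y|]; last by apply/imsetP=> -[].
  by have [z _ <-] := psi_some y; rewrite mem_imset ?in_setT //; exact: (pcan_inj psiK).
exists (push phi psi f); split=> //.
by rewrite -[[set None]]setU0; apply: matingU; rewrite ?E.
Qed.

End ContractTransport.

(** * Factor-components *)

Section FactorConnected.
Variable G : sgraph.
Implicit Types (f g p : {ffun G -> G}) (H S T W X Y Z : {set G}) (a b s t u v w x y z h : G).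

Notation D0 := (@exposable G set0).
Notation A0 := (neighbours (@exposable G set0)).
Notation d0 := (@dfc G set0).

Lemma allowed_sym : symmetric (@allowed G).
Proof.
move=> u v; apply/allowedP/allowedP=> -[e [f fo fu]]; rewrite edge_sym; split=> //.
  by exists f; rewrite // -fu (mating_inv (optimal_mating fo)).
by exists f; rewrite // -fu (mating_inv (optimal_mating fo)).
Qed.

Lemma fconn_sym : connect_sym (@allowed G).
Proof. exact: sym_connect_sym allowed_sym. Qed.

Lemma fconnC x y : factor_connected x y = factor_connected y x.
Proof. exact: fconn_sym. Qed.

Lemma allowed_mate f u : optimal set0 f -> f u != u -> allowed u (f u).
Proof.
move=> fo fu; apply/allowedP; split; last by exists f.
exact: mating_edge (optimal_mating fo) fu.
Qed.

Lemma fconn_mate f u : optimal set0 f -> factor_connected u (f u).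
Proof.
move=> fo; have [->|fu] := eqVneq (f u) u; first exact: connect0.
by apply: connect1; apply: allowed_mate.
Qed.

Lemma add_optimal f s v : mating set0 f -> f s = s -> f v = v -> #|fixes f| <= d0 + 2 ->
  edge s v -> optimal set0 (add f s v).
Proof.
move=> fm fs fv cf sv.
have am : mating set0 (add f s v) by apply: add_mating; rewrite ?inE.
rewrite /optimal am eqn_leq dfc_le // andbT -(leq_add2r 2) card_add //.
Qed.

Lemma allowed_cofree s v : v \in cofree s -> edge s v -> allowed s v.
Proof.
case/cofreeP=> vs [f [fm fs fv cf]] sv; apply/allowedP; split=> //.
by exists (add f s v); [exact: add_optimal | rewrite ffunE eqxx].
Qed.

(** Every optimal mating sends a barrier vertex [x] into [cofree x], which is contained in
    [cofree s]. *)
Lemma allowed_border s x y : s \notin D0 -> allowed x y ->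
  x \in cofree s :|: border s -> y \in cofree s :|: border s.
Proof.
move=> sD /allowedP[xy [f fo fx]] /setUP[xE|xB]; rewrite inE; last first.
  rewrite -fx (subsetP (border_cofree_sub sD xB)) //; apply: mate_cofree fo _.
  exact: border_exposable sD xB.
have [->//|h] := neighbours_or xE xy.
by rewrite /border h orbT.
Qed.

Lemma fconn_border s t : s \notin D0 -> factor_connected s t ->
  t \in cofree s :|: border s.
Proof.
move=> sD; have imp (p : seq G) x : path (@allowed G) x p -> x \in cofree s :|: border s ->
    last x p \in cofree s :|: border s.
  elim: p x => [|z p IHp] x //= /andP[xz pz] xX.
  exact: IHp pz (allowed_border sD xz xX).
case/connectP=> p pp ->; apply: imp pp _.
by rewrite in_setU border_self ?orbT.
Qed.

Lemma cofree_dfc u v : u != v ->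
  (v \in cofree u) = (dfc [set u; v] <= d0 + 2).
Proof.
move=> uv; apply/cofreeP/idP=> [[_ [f [fm fu fv cf]]]|le].
  apply: leq_trans cf; apply: dfc_le; rewrite -[[set u; v]]setU0; apply: matingU => //.
  by apply/subsetP=> z /set2P[]->; rewrite inE; apply/eqP.
have [f fo] := optimal_ex [set u; v]; have fm := optimal_mating fo.
split; first by rewrite eq_sym.
exists f; split; rewrite ?(optimal_card fo) //.
- exact: matingS (sub0set _) fm.
- by apply: mating_fix fm _; rewrite !inE eqxx.
- by apply: mating_fix fm _; rewrite !inE eqxx orbT.
Qed.

(** The deficiency grows exactly when [v] is outside [cofree u]. Factor-connected vertices of this
    kind lie in each other's [border], which gives both inclusions. *)
Lemma gklE u v : u \notin D0 -> v \notin D0 ->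
  gkl u v = factor_connected u v && (cofree u == cofree v).
Proof.
move=> uD vD; rewrite /gkl; have [->|uv] /= := eqVneq u v.
  by rewrite /factor_connected connect0 eqxx.
case: (boolP (factor_connected u v)) => //= cuv.
have := induced_deficiency (~: [set u; v]); rewrite setCK cards2 uv => dE.
rewrite deficiencyE -(ltn_add2r 2) dE ltnNge -cofree_dfc //.
apply/idP/eqP=> [vE|->]; last exact: cofree_irr.
have /setUP[|vB] := fconn_border uD cuv; first by rewrite (negPf vE).
rewrite fconnC in cuv.
have /setUP[|uB] := fconn_border vD cuv; first by rewrite cofree_sym (negPf vE).
by apply/eqP; rewrite eqEsubset !border_cofree_sub.
Qed.

(* [cofree b = cofree c] is a union of near-perfectly matched components: the path
   joining in one of them the mates of [b] and [c] consists of allowed edges. *)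
Lemma mutual_step b c f v : b \notin D0 -> c \notin D0 -> cofree b = cofree c ->
  optimal set0 f -> connect (within (cofree b)) (f b) v -> edge v c ->
  factor_connected b c.
Proof.
move=> bD cD Ebc fo bv vc; have fm := optimal_mating fo.
have fb := optimal_notin fo bD; have fbE := mate_cofree fo bD.
have vE : v \in cofree c by rewrite -Ebc; apply: within_mem bv fbE.
(* [p] exposes [c] and its neighbour [v]; with the edge [c v] added it is optimal, so its edges are
   allowed. *)
have [vNc [p [pm pc pv cp]]] := cofreeP _ _ vE.
have cv : edge c v by rewrite edge_sym.
have po := add_optimal pm pc pv cp cv.
have bfb : factor_connected b (f b) by exact: fconn_mate.
have vcC : factor_connected v c.
  by rewrite fconnC; apply/connect1/allowed_cofree.
have [fbv|fbv] := eqVneq (f b) v.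
  by apply: connect_trans bfb _; rewrite fbv.
set g := rmv f b; set x := f b in bv fbE bfb fbv *.
have gm : mating set0 g by apply: matingS (sub0set _) (rmv_mating b fm).
have gE z : g z = if (z == b) || (z == f b) then z else f z by apply: rmvE fm.
have gx : g x = x by rewrite gE eqxx orbT.
have gb : g b = b by rewrite gE eqxx.
have cg : #|fixes g| = d0 + 2 by rewrite (card_rmv fm fb) (optimal_card fo).
have cB : c \in border c := border_self cD.
have pfix z : z \in fixes p -> p z = z by rewrite inE => /eqP.
(* [v] and [x] lie in one component of G[cofree c], and exposing the barrier vertex [c] already
   accounts for the two extra exposed vertices. *)
have notboth q : mating set0 q -> #|fixes q| <= d0 + 2 -> q c = c -> q v = v -> q x = x -> False.
  move=> qm cq qc qv qx; apply: (@tight_eq _ c q x v cD qm) => //.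
  - apply: leq_trans cq _; rewrite leq_add2l -[2]/(2 * 1) leq_mul2l /= card_gt0.
    by apply/set0Pn; exists c; rewrite inE cB inE qc eqxx.
  - by rewrite -Ebc.
  - by rewrite qx eqxx.
  - by rewrite qv eqxx.
have px : p x != x by apply/eqP=> px; apply: notboth pm cp pc pv px.
have [p' [g' [w [p'm g'm xw wx kind]]]] := exchange pm gm gx px.
have xwC : factor_connected x w.
  apply: connect_sub xw => a a' /orP[] /eqP <-.
    have [->|pa] := eqVneq (p a) a; first exact: connect0.
    have := @fconn_mate _ a po; rewrite ffunE.
    case: eqP => [ac|_]; first by rewrite ac pc eqxx in pa.
    by case: eqP => [av|_]; first by rewrite av pv eqxx in pa.
  rewrite gE; case: ifP => _; first exact: connect0.
  exact: fconn_mate.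
have bw : factor_connected b w by apply: connect_trans bfb xwC.
(* A path ending at a vertex missed by [p] other than [c] and [v] would contradict [notboth]. *)
case: kind => [[pw Ep' _ cp' _]|[gw Ep' Eg' cp' cg']].
  have [wc|wc] := eqVneq w c; first by rewrite -wc.
  have [wv|wv] := eqVneq w v; first by apply: connect_trans bw _; rewrite wv.
  have p'fix z : p z = z -> z != w -> p' z = z.
    by move=> pz zw; apply/eqP; rewrite -in_fixes Ep' !inE zw pz eqxx orbT.
  exfalso; apply: (notboth p' p'm); rewrite ?cp' //; try by apply: p'fix => //; rewrite eq_sym.
  by apply/eqP; rewrite -in_fixes Ep' !inE eqxx.
(* An end other than [b] would leave [g'] optimal and missing [b], which is outside D(G). *)
have [wb|wb] := eqVneq w b; last first.
  case/negP: bD; apply/exposableP; exists g'.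
    by rewrite /optimal g'm -(eqn_add2r 2) cg' cg eqxx.
  apply/eqP; rewrite -in_fixes Eg' !inE eq_sym wb gb eqxx andbT /=.
  by rewrite eq_sym.
have [<-|bc] := eqVneq b c; first exact: connect0.
have p'fix z : z \in [:: x; w] \/ p z = z -> p' z = z.
  move=> h; apply/eqP; rewrite -in_fixes Ep' !inE; move: h; rewrite !inE.
  by case=> [/orP[]->|->]; rewrite ?eqxx ?orbT.
(* Now [p'] exposes two barrier vertices, [b] and [c], which compensates for its two further exposed
   vertices. *)
exfalso; apply: (@tight_eq _ c p' x v cD p'm) => //.
- rewrite cp'; apply: (@leq_trans (d0 + 2 * 2)); first by move: cp; clear; lia.
  rewrite leq_add2l leq_mul2l /=.
  apply: (@leq_trans #|[set b; c]|); first by rewrite cards2 bc.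
  apply/subset_leq_card/subsetP=> z /set2P[]->; rewrite inE; apply/andP; split.
  + by rewrite inE p'fix // wb !inE eqxx orbT; left.
  + by apply: cofree_sub_border => //; rewrite Ebc.
  + by rewrite inE p'fix //; right.
  + exact: cB.
- by rewrite -Ebc.
- by rewrite p'fix ?eqxx // !inE eqxx; left.
- by rewrite p'fix ?eqxx //; right.
Qed.

End FactorConnected.

(** * Factor-connection read off from [cofree], and the order on factor-components *)

Section Order.
Variable G : sgraph.
Implicit Types (f g p : {ffun G -> G}) (H K S T W X Y Z : {set G}) (a b s t u v w x y z h k : G).

Notation D0 := (@exposable G set0).
Notation A0 := (neighbours (@exposable G set0)).
Notation d0 := (@dfc G set0).

(* C(G) of the Gallai-Edmonds decomposition. *)
Definition core : {set G} := ~: (D0 :|: A0).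

Lemma coreP x : reflect (x \notin D0 /\ x \notin A0) (x \in core).
Proof. by rewrite in_setC in_setU negb_or; apply: andP. Qed.

Lemma core_exposable x : x \in core -> x \notin D0.
Proof. by case/coreP. Qed.

(** The mates of vertices of A(G) in optimal matings lie in D(G), so an allowed edge from the core
    cannot end in A(G). *)
Lemma allowed_core x y : allowed x y -> x \in core -> y \in core.
Proof.
move=> xy /coreP[xD xA]; have [exy _] := allowedP _ _ xy.
apply/coreP; split; first last.
  rewrite allowed_sym in xy; have [_ [f fo fy]] := allowedP _ _ xy.
  apply: contra xD => yA; rewrite -(barrier_cofree yA) -fy; apply: mate_cofree fo _.
  by case/neighboursP: yA.
apply: contra xA => yD; apply/neighboursP; split=> //; exists y => //.
by rewrite edge_sym.
Qed.

Lemma connect_stable (e : rel G) (P : pred G) x y :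
  (forall a b, e a b -> P a -> P b) -> connect e x y -> P x -> P y.
Proof.
move=> Pe /connectP[p]; elim: p x => [|z p IHp] x /=; first by move=> _ ->.
by case/andP=> xz pz ly Px; apply: IHp pz ly (Pe _ _ xz Px).
Qed.

Lemma fconn_core x y : factor_connected x y -> x \in core -> y \in core.
Proof. by apply: connect_stable => a b; apply: allowed_core. Qed.

Lemma fconn_exit x h s : factor_connected h s -> h \in cofree x -> s \notin cofree x ->
  exists2 b, b \in border x & factor_connected h b.
Proof.
case/connectP=> p; elim: p h => [|z p IHp] h /=; first by move=> _ -> ->.
case/andP=> hz pz ls hE sE; have [ehz _] := allowedP _ _ hz.
have [zE|zB] := neighbours_or hE ehz.
  have [b bB zb] := IHp _ pz ls zE sE.
  by exists b => //; apply: connect_trans zb; apply: connect1.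
by exists z => //; apply: connect1.
Qed.

Lemma cofree_core s : s \in core -> cofree s != D0.
Proof.
move=> /coreP[sD sA]; have [f fo] := optimal_ex (set0 : {set G}).
apply/eqP=> E; case/negP: sA; apply/neighboursP; split=> //.
by exists (f s); [rewrite -E; exact: mate_cofree | exact: mate_edge].
Qed.

(* Closure argument: starting from the vertices [b] with [cofree b = cofree s]
   that are factor-connected to [s], and from those with [cofree b] strictly
   smaller, one exhausts [cofree s]; so [t] is a neighbour of the former. *)
Lemma cofree_eq_fconn s t : s \in core -> t \notin D0 -> cofree s = cofree t ->
  factor_connected s t.
Proof.
move=> sC tD Est; have sD := core_exposable sC.
have [f fo] := optimal_ex (set0 : {set G}).
set E := cofree s.
pose Zb := [set b | [&& b \notin D0, cofree b == E & factor_connected s b]].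
pose Qb := [set b in border s | cofree b != E].
(* The components of G[E] that contain the mate of a vertex of [Zb]; by [mutual_step], their outer
   neighbours [x] with [cofree x = E] are again in [Zb]. *)
pose Y := [set y in E | [exists b in Zb, connect (within E) (f b) y]].
pose Y' := Y :|: \bigcup_(b in Qb) cofree b :|: D0.
have QD b : b \in Qb -> b \notin D0.
  by rewrite inE => /andP[/(border_exposable sD)].
have sub : cofree s \subset Y'.
  apply: (@cofree_closure _ f s Y' (Zb :|: Qb)) => //.
  - rewrite !subUset exposable_cofree // andbT; apply/andP; split.
      by apply/subsetP=> y; rewrite inE => /andP[].
    by apply/bigcupsP=> b; rewrite inE => /andP[bB _]; apply: border_cofree_sub.
  - rewrite subUset; apply/andP; split; last by apply/subsetP=> b; rewrite inE => /andP[].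
    apply/subsetP=> b; rewrite inE => /and3P[bD /eqP bE _].
    by apply: cofree_sub_border; rewrite ?bE.
  - by rewrite inE; apply/orP; left; rewrite inE sD eqxx; exact: connect0.
  - exact: subsetUr.
  - apply/subsetP=> x /neighboursP[xY [y yY yx]].
    have QI : x \in border s -> cofree x \subset E -> cofree x != E -> x \in Zb :|: Qb.
      by move=> xB _ xE; rewrite inE; apply/orP; right; rewrite inE xB xE.
    case/setUP: yY => [/setUP[]|].
    + rewrite inE => /andP[yE /existsP[b /andP[bZ by']]].
      have [xE|xB] := neighbours_or yE yx.
        have xInY : x \in Y.
          rewrite inE xE; apply/existsP; exists b; rewrite bZ.
          by apply: connect_trans by' _; apply: within1.
        by case/negP: xY; rewrite !in_setU xInY.
      rewrite inE; case: (boolP (x \in Qb)) => xQ; first by rewrite orbT.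
      rewrite orbF; have xE : cofree x = E.
        by apply/eqP; apply: contraNT xQ => xE; rewrite inE xE andbT.
      move: bZ; rewrite inE => /and3P[bD /eqP bE sb].
      rewrite inE (border_exposable sD xB) xE eqxx /=.
      apply: connect_trans sb _; apply: mutual_step fo _ yx => //; first exact: border_exposable sD xB.
        by rewrite bE xE.
      by rewrite bE.
    + case/bigcupP=> b bQ yb; have bD := QD _ bQ.
      have [xE|xB] := neighbours_or yb yx.
        case/negP: xY; rewrite in_setU; apply/orP; left; rewrite in_setU; apply/orP; right.
        by apply/bigcupP; exists b.
      move: bQ; rewrite inE => /andP[bB bE].
      have xb := border_cofree_sub bD xB.
      have bs := border_cofree_sub sD bB.
      apply: QI; first exact: subsetP (border_sub sD bB) _ xB.
        exact: subset_trans xb bs.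
      apply: contra bE => /eqP xE; rewrite eqEsubset bs /= -/E -xE //.
    + move=> yD; have [xD|xA] := neighbours_or yD yx.
        by case/negP: xY; rewrite in_setU xD orbT.
      apply: QI; first exact: subsetP (barrier_border sD) _ xA.
        by rewrite barrier_cofree // exposable_cofree.
      by rewrite barrier_cofree // eq_sym cofree_core.
  - move=> b /setUP[bZ|bQ].
      rewrite !in_setU; apply/orP; left; apply/orP; left; rewrite inE.
      move: (bZ); rewrite inE => /and3P[bD /eqP bE _].
      rewrite -bE mate_cofree //; apply/existsP; exists b; rewrite bZ; exact: connect0.
    rewrite !in_setU; apply/orP; left; apply/orP; right; apply/bigcupP; exists b => //.
    apply: mate_cofree fo _; exact: QD.
(* The mate of [t] falls into one of the three pieces of [Y']: the first yields the conclusion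
   through [mutual_step], the other two contradict the strictness in [Qb] and the choice of [s] in
   the core. *)
have ftY : f t \in Y' by apply: (subsetP sub); rewrite Est mate_cofree.
have tE : t \notin E by rewrite /E Est cofree_irr.
have ft := mate_edge fo tD.
have tsB : t \in border s by apply: cofree_sub_border; rewrite ?Est.
case/setUP: ftY => [/setUP[]|ftD].
- rewrite inE => /andP[yE /existsP[b /andP[]]]; rewrite inE => /and3P[bD /eqP bE sb] by'.
  apply: connect_trans sb _; apply: (mutual_step bD tD _ fo (v := f t)) => //.
    by rewrite bE.
  by rewrite bE.
- case/bigcupP=> b; rewrite inE => /andP[bB bE] tb.
  have bD := border_exposable sD bB.
  have bs := border_cofree_sub sD bB.
  have [tb'|tb'] := neighbours_or tb ft.
    by case/negP: tE; apply: (subsetP bs).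
  case/negP: bE; rewrite eqEsubset bs /E Est; exact: border_cofree_sub bD tb'.
have := exposable_cofree sD => DE.
have [tD'|tA] := neighbours_or ftD ft; first by case/negP: tD.
by have := cofree_core sC; rewrite Est barrier_cofree // eqxx.
Qed.

Definition fcomp x := [set y | factor_connected x y].

Lemma in_fcomp x y : (y \in fcomp x) = factor_connected x y.
Proof. by rewrite inE. Qed.

Lemma fcomp_refl x : x \in fcomp x.
Proof. by rewrite inE; apply: connect0. Qed.

Lemma fcomp_eq x y : y \in fcomp x -> fcomp y = fcomp x.
Proof.
rewrite inE => xy; apply/setP=> z; rewrite !inE.
by rewrite /factor_connected (same_connect (@fconn_sym G) xy).
Qed.

Lemma fcomp_component x : fcomp x \in factor_components G.
Proof.
rewrite inE; apply/maxsetP; split.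
  apply/andP; split; first by apply/set0Pn; exists x; exact: fcomp_refl.
  apply/forall_inP=> u ux; apply/forall_inP=> v vx.
  by rewrite -in_fcomp (fcomp_eq ux).
move=> B /andP[_ /forall_inP Bc] sub; apply/eqP; rewrite eqEsubset sub andbT.
apply/subsetP=> y yB; rewrite inE.
by have /forall_inP/(_ _ yB) := Bc _ (subsetP sub _ (fcomp_refl x)).
Qed.

Lemma component_fcomp H x : H \in factor_components G -> x \in H -> H = fcomp x.
Proof.
rewrite inE => /maxsetP[/andP[_ /forall_inP Hc] max] xH.
have := fcomp_component x; rewrite inE => /maxsetP[Fc _].
symmetry; apply: max Fc _; apply/subsetP=> y yH; rewrite inE.
by have /forall_inP/(_ _ yH) := Hc _ xH.
Qed.

Lemma component_ex H : H \in factor_components G -> exists x, H = fcomp x.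
Proof.
move=> HF; move: (HF); rewrite inE => /maxsetP[/andP[/set0Pn[x xH] _] _].
by exists x; apply: component_fcomp.
Qed.

Definition allowed_closed X := forall x y, allowed x y -> x \in X -> y \in X.

Lemma closed_fcomp X x : allowed_closed X -> x \in X -> fcomp x \subset X.
Proof.
move=> Xc xX; apply/subsetP=> y; rewrite inE => xy.
by apply: (@connect_stable _ (mem X) x y Xc xy).
Qed.

Lemma separatingP X : reflect (allowed_closed X) (separating X).
Proof.
apply: (iffP existsP) => [[F /and3P[/subsetP FF _ /eqP <-]] x y xy|Xc].
  case/bigcupP=> H HF xH; apply/bigcupP; exists H => //.
  by rewrite (component_fcomp (FF _ HF) xH) inE; apply: connect1.
exists [set fcomp x | x in X]; apply/and3P; split.
- by apply/subsetP=> H /imsetP[x _ ->]; exact: fcomp_component.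
- apply/trivIsetP=> A B /imsetP[x _ ->] /imsetP[y _ ->] xy.
  apply/pred0P=> z /=; apply/negbTE; apply: contra xy => /andP[zx zy].
  by rewrite -(fcomp_eq zx) -(fcomp_eq zy).
apply/eqP/setP=> z; apply/bigcupP/idP=> [[H /imsetP[x xX ->]]|zX].
  exact: subsetP (closed_fcomp Xc xX) z.
by exists (fcomp z); [exact: imset_f | exact: fcomp_refl].
Qed.

Lemma fcomp_closed x : allowed_closed (fcomp x).
Proof.
by move=> y z yz; rewrite !inE => xy; apply: connect_trans xy (connect1 yz).
Qed.

Lemma closedD X x : allowed_closed X -> allowed_closed (X :\: fcomp x).
Proof.
move=> Xc y z yz /setDP[yX yx]; apply/setDP; split; first exact: Xc yz yX.
by apply: contra yx; apply: fcomp_closed; rewrite allowed_sym.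
Qed.

Lemma fc_leP H1 H2 :
  reflect (exists X, [/\ allowed_closed X, H1 :|: H2 \subset X &
     factor_critical (contract [set x : induced X | val x \in H1])]) (fc_le H1 H2).
Proof.
by apply: (iffP existsP) => -[X]; [case/and3P=> /separatingP | case=> /separatingP]; exists X => //; apply/and3P.
Qed.

Lemma fc_le_refl x : fc_le (fcomp x) (fcomp x).
Proof.
apply/fc_leP; exists (fcomp x); split; rewrite ?setUid //; first exact: fcomp_closed.
apply/contract_criticalP => //; rewrite setDv; split=> [|z]; last by rewrite inE.
exists [ffun z => z]; split; first exact: id_mating.
by apply/setP=> z; rewrite !inE ffunE eqxx.
Qed.

Lemma component_closed f X z : allowed_closed X -> optimal set0 f -> (f z \in X) = (z \in X).
Proof.
move=> Xc fo; have imp u : u \in X -> f u \in X.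
  have [->//|fu] := eqVneq (f u) u.
  by apply: Xc; apply: allowed_mate.
by apply/idP/idP=> /imp; rewrite ?(mating_inv (optimal_mating fo)).
Qed.

Definition glue Z p f : {ffun G -> G} := [ffun z => if z \in Z then p z else f z].

Lemma glue_mating Z p f : mating (~: Z) p -> mating set0 f ->
  (forall z, (f z \in Z) = (z \in Z)) -> mating set0 (glue Z p f).
Proof.
move=> pm fm fZ; apply/matingP; split=> [z|z|z]; last by rewrite inE.
  rewrite !ffunE; case: (boolP (z \in Z)) => zZ.
    have := mating_out pm (x := z); rewrite !inE !negbK => -> //.
    exact: mating_inv pm z.
  by rewrite fZ (negPf zZ) (mating_inv fm).
by rewrite ffunE; case: ifP => _; [exact: mating_edge pm | exact: mating_edge fm].
Qed.

(** Gluing a perfect mating of [X :\: fcomp s] onto an optimal mating shows that no optimal mating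
    misses a vertex there. Gluing instead the mating that misses [x] and a neighbour [u] of
    [fcomp s] shows [u \in cofree x]. *)
Lemma upper_witness s x : x \in Ustrict (fcomp s) ->
  [/\ x \notin D0, x \notin fcomp s & exists u h,
     [/\ u \in cofree x, h \in fcomp s & edge u h]].
Proof.
case/bigcupP=> H' /andP[H'F /andP[/fc_leP[X [Xc HX]]]] crit H's xH'.
have xs : x \notin fcomp s.
  apply: contra H's => xs; rewrite (component_fcomp H'F xH').
  by rewrite (fcomp_eq xs).
have xX : x \in X by apply: (subsetP HX); rewrite inE xH' orbT.
have sX : fcomp s \subset X by apply: subset_trans (subsetUl _ _) HX.
have [[p [pm pE]] fc] := contract_criticalP sX crit.
set Z := X :\: fcomp s in pm pE fc.
have Zc : allowed_closed Z by exact: closedD.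
have xZ : x \in Z by rewrite inE xs xX.
have noD f z : optimal set0 f -> z \in Z -> f z != z.
  move=> fo zZ; apply/negP=> fz.
  have km := glue_mating pm (optimal_mating fo) (fun z => component_closed z Zc fo).
  have : fixes (glue Z p f) \proper fixes f.
    apply/properP; split; last first.
      exists z; rewrite ?inE // ffunE zZ; apply/negP=> pz.
      have : z \in fixes p by rewrite inE.
      by rewrite pE inE zZ.
    apply/subsetP=> y; rewrite !inE ffunE; case: ifP => // yZ py.
    have : y \in fixes p by rewrite inE.
    by rewrite pE inE yZ.
  by move/proper_card; rewrite (optimal_card fo) ltnNge dfc_le.
have xD : x \notin D0.
  by apply/negP=> /exposableP[f fo /eqP]; apply/negP/noD.
split=> //; have [u [h [q [uZ ux hs uh [qm qE]]]]] := fc x xZ.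
exists u, h; split=> //.
have [f fo] := optimal_ex (set0 : {set G}).
have km := glue_mating qm (optimal_mating fo) (fun z => component_closed z Zc fo).
apply/cofreeP; split=> //; exists (glue Z q f); split=> //.
- by apply/eqP; rewrite ffunE xZ -in_fixes qE !inE eqxx ?orbT.
- by apply/eqP; rewrite ffunE uZ -in_fixes qE !inE eqxx ?orbT.
rewrite -(optimal_card fo).
have sub : fixes (glue Z q f) \subset fixes f :|: [set x; u].
  apply/subsetP=> y; rewrite !inE ffunE; case: ifP => [yZ|_ ->//].
  rewrite -in_fixes qE in_setU in_setC yZ /= !inE => ->; exact: orbT.
apply: leq_trans (subset_leq_card sub) _.
apply: leq_trans (leq_of_leqif (leq_card_setU _ _)) _.
by rewrite leq_add2l cards2; case: (x != u).
Qed.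

End Order.

(** * Upper bounds of a factor-component *)

Section UpperBounds.
Variable G : sgraph.
Implicit Types (f g p : {ffun G -> G}) (H K S T W X Y Z : {set G}) (a b s t u v w x y z h k : G).

Notation D0 := (@exposable G set0).
Notation A0 := (neighbours (@exposable G set0)).
Notation d0 := (@dfc G set0).

Lemma fcomp_core s x : s \in core G -> x \in fcomp s -> x \in core G.
Proof. by rewrite in_fcomp => sC sx; apply: fconn_core sx sC. Qed.

(** Factor-connected vertices outside each other's [cofree] lie in each other's [border]. *)
Lemma fcomp_cofree s x : s \in core G -> x \in fcomp s -> x \notin cofree s ->
  cofree x = cofree s.
Proof.
move=> sC xs xE; have xC := fcomp_core sC xs.
have sD := core_exposable sC; have xD := core_exposable xC.
rewrite in_fcomp in xs; have := fconn_border sD xs.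
rewrite in_setU (negPf xE) => xB.
rewrite fconnC in xs; have := fconn_border xD xs.
rewrite in_setU cofree_sym (negPf xE) => sB.
by apply/eqP; rewrite eqEsubset !border_cofree_sub.
Qed.

(** Otherwise [cofree x] is contained in [cofree s], and some [b] in both [fcomp s] and [border x]
    has [cofree b = cofree s]. Then [cofree x = cofree s], and [cofree_eq_fconn] puts [x] into
    [fcomp s]. *)
Lemma upper_border s x : s \in core G -> x \in Ustrict (fcomp s) -> x \notin border s.
Proof.
move=> sC xU; apply/negP=> xB; have sD := core_exposable sC.
have [xD xs [u [h [uE hs uh]]]] := upper_witness xU.
have sEx : s \notin cofree x by rewrite -cofree_sym border_notin.
have sub := border_cofree_sub sD xB.
have [b bB bs] : exists2 b, b \in border x & b \in fcomp s.
  have [hE|hB] := neighbours_or uE uh; last by exists h.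
  have hs' : factor_connected h s by rewrite fconnC -in_fcomp.
  have [b bB hb] := fconn_exit hs' hE sEx.
  by exists b => //; rewrite in_fcomp; rewrite in_fcomp in hs; apply: connect_trans hs hb.
have subb := border_cofree_sub xD bB.
have bE : b \notin cofree s.
  by rewrite cofree_sym; apply: contra sEx; apply: (subsetP subb).
have E := fcomp_cofree sC bs bE.
case/negP: xs; rewrite in_fcomp; apply: cofree_eq_fconn => //.
by apply/eqP; rewrite eqEsubset sub -E subb.
Qed.

Lemma fcomp_within X x y : allowed_closed X -> x \in X -> factor_connected x y ->
  connect (within X) x y.
Proof.
move=> Xc xX /connectP[p]; elim: p x xX => [|z p IHp] x xX /=.
  by move=> _ ->; exact: connect0.
case/andP=> xz pz ly; have zX := Xc _ _ xz xX.
apply: connect_trans (IHp _ zX pz ly); apply: within1 => //.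
by case/allowedP: xz.
Qed.

Lemma componentsP X K :
  reflect (exists2 x, x \in X & K = [set y in X | connect (within X) x y])
          (K \in components X).
Proof. exact: imsetP. Qed.

Lemma Ustrict_closed H : allowed_closed (Ustrict H).
Proof.
move=> x y xy /bigcupP[H' /andP[H'F h] xH']; apply/bigcupP; exists H'.
  by rewrite H'F.
rewrite (component_fcomp H'F xH'); apply: fcomp_closed xy (fcomp_refl x).
Qed.

Lemma UnonstrictE s : Unonstrict (fcomp s) = fcomp s :|: Ustrict (fcomp s).
Proof.
apply/setP=> x; apply/bigcupP/setUP=> [[H /andP[HF le] xH]|[xs|]].
- have [Hs|Hs] := eqVneq H (fcomp s); first by left; rewrite -Hs.
  by right; apply/bigcupP; exists H; rewrite ?HF ?le.
- by exists (fcomp s); rewrite ?fcomp_component ?fc_le_refl.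
by case/bigcupP=> H /andP[HF /andP[le _]] xH; exists H; rewrite ?HF.
Qed.

Lemma Ubase_sub H S : Ubase H S \subset Ustrict H.
Proof.
apply/subsetP=> x /bigcupP[H' /andP[_ /exists_inP[K /componentsP[y yU ->]]]].
by case/andP=> _ /subsetP sub /sub; rewrite inE => /andP[].
Qed.

(** The component of G[U(H)] that contains [x] contains all of [fcomp x], so it must have a
    neighbour in [H] outside [S]. *)
Lemma notin_Ubase H S x : x \in Ustrict H -> x \notin Ubase H S ->
  exists k h, [/\ connect (within (Ustrict H)) x k, h \in H, h \notin S & edge k h].
Proof.
move=> xU xN; set K := [set y in Ustrict H | connect (within (Ustrict H)) x y].
have KC : K \in components (Ustrict H) by apply/componentsP; exists x.
have sub : fcomp x \subset K.
  apply/subsetP=> y yx; rewrite inE; apply/andP; split.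
    by apply: subsetP y yx; apply: closed_fcomp xU; exact: Ustrict_closed.
  by rewrite in_fcomp in yx; apply: fcomp_within yx => //; exact: Ustrict_closed.
case: (boolP (neighbours K :&: H \subset S)) => [NS|/subsetPn[h /setIP[hN hH] hS]].
  case/negP: xN; apply/bigcupP; exists (fcomp x); last exact: fcomp_refl.
  by rewrite fcomp_component; apply/exists_inP; exists K; rewrite ?NS.
have [_ [k kK kh]] := neighboursP _ _ hN; exists k, h; split=> //.
by move: kK; rewrite inE => /andP[].
Qed.

Lemma Ubase_neighbour s S y v : y \in Ubase (fcomp s) S -> edge v y ->
  v \in Unonstrict (fcomp s) -> v \in S \/ v \in Ubase (fcomp s) S.
Proof.
set U := Ustrict (fcomp s).
case/bigcupP=> H' /andP[H'F /exists_inP[K KC /andP[NS H'K]]] yH' vy.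
have [x xU KE] := componentsP _ _ KC.
have yK := subsetP H'K _ yH'.
rewrite UnonstrictE => /setUP[vs|vU].
  left; apply: (subsetP NS); rewrite inE vs andbT; apply/neighboursP; split.
    rewrite KE inE; apply/negP=> /andP[/upper_witness[_ /negP]]; by [].
  by exists y; rewrite // edge_sym.
have [yU xy] : y \in U /\ connect (within U) x y by apply/andP; move: yK; rewrite KE inE.
right; apply/bigcupP; exists (fcomp v); last exact: fcomp_refl.
rewrite fcomp_component; apply/exists_inP; exists K => //; rewrite NS /=.
have Uc : allowed_closed U by exact: Ustrict_closed.
apply/subsetP=> z zv; rewrite KE inE; apply/andP; split.
  exact: subsetP (closed_fcomp Uc vU) z zv.
apply: connect_trans xy _; apply: (@connect_trans _ _ v).
  by apply: within1; rewrite // edge_sym.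
by rewrite in_fcomp in zv; apply: fcomp_within zv.
Qed.

(** * The upper bounds above a class of a consistent factor-component *)

Section Consistent.
Variable s : G.
Hypothesis sC : s \in core G.

Let E := cofree s.
Let H := fcomp s.
Let U := Ustrict H.
Let sD : s \notin D0 := core_exposable sC.

(** The general Kotzig-Lovasz class of [s], in the form suggested by [gklE]. *)
Definition gkl_class : {set G} := [set y in fcomp s | cofree y == cofree s].

Lemma gkl_classN x : x \in H -> x \notin gkl_class -> x \in E.
Proof.
move=> xH; apply: contraR => xE; rewrite inE xH.
by rewrite (fcomp_cofree sC xH xE) /=.
Qed.

Lemma gkl_class_notin x : x \in gkl_class -> x \notin E.
Proof. by rewrite inE => /andP[_ /eqP xE]; rewrite /E -xE cofree_irr. Qed.

Definition upper : {set G} := (Unonstrict H :\: gkl_class) :\: Ubase H gkl_class.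

Lemma upperP x : reflect (x \in H /\ x \notin gkl_class \/
    x \in U /\ x \notin Ubase H gkl_class) (x \in upper).
Proof.
rewrite !in_setD UnonstrictE in_setU -/H -/U.
case: (boolP (x \in H)) => xH /=.
  have xU : x \notin U by apply/negP=> /upper_witness[_ /negP].
  have xB : x \notin Ubase H gkl_class by apply: contra xU; apply: (subsetP (Ubase_sub _ _)).
  rewrite xB andbT /=; apply: (iffP idP) => [h|[[]|[xU']]] //; first by left.
  by rewrite xU' in xU.
have xS : x \notin gkl_class by rewrite inE -/H (negPf xH).
rewrite xS /=; apply: (iffP andP) => [[xB xU]|[[]|[]]] //; by right.
Qed.

(** A walk inside [U] cannot leave [E], because it would have to enter [border s], which [U]
    avoids. *)
Lemma upper_conn k z : k \in E -> connect (within U) k z ->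
  z \in E /\ connect (within E) k z.
Proof.
move=> kE /connectP[p]; elim: p k kE => [|y p IHp] k kE /=.
  by move=> _ ->; split; last exact: connect0.
case/andP=> /and3P[_ yU ky] py lz.
have yE : y \in E.
  by have [//|yB] := neighbours_or kE ky; case/negP: (upper_border sC yU).
have [zE yz] := IHp _ yE py lz; split=> //.
by apply: connect_trans yz; apply: within1.
Qed.

Lemma upper_connected x : x \in upper ->
  x \in E /\ exists h, [/\ h \in H, h \notin gkl_class & connect (within E) x h].
Proof.
case/upperP=> [[xH xS]|[xU xB]].
  by split; [exact: gkl_classN | exists x; split=> //; exact: connect0].
have [k [h [xk hH hS kh]]] := notin_Ubase xU xB.
have hE := gkl_classN hH hS.
have kU : k \in U by apply: within_mem xk xU.
have hk : edge h k by rewrite edge_sym.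
have kE : k \in E.
  by have [//|kB] := neighbours_or hE hk; case/negP: (upper_border sC kU).
have kx : connect (within U) k x by rewrite within_sym.
have [xE kx'] := upper_conn kE kx; split=> //; exists h; split=> //.
by apply: connect_trans (within1 kE hE kh); rewrite within_sym.
Qed.

Lemma upper_cofree x : x \in upper -> x \in E.
Proof. by case/upper_connected. Qed.

(** The component [K] of [y] in G[E] is added to [H]: the union is separating and its contraction by
    [H] is factor-critical. *)
Lemma cofree_upper_strict y h : y \in E -> y \notin H -> h \in H -> h \in E ->
  connect (within E) y h -> y \in U.
Proof.
move=> yE yH hH hE yh.
pose K := [set z | connect (within E) y z].
have yK : y \in K by rewrite inE; exact: connect0.
have KE z : z \in K -> z \in E by rewrite inE => /within_mem; apply.
have Kh z : z \in K -> connect (within E) z h.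
  by rewrite inE => yz; apply: connect_trans yh; rewrite within_sym.
have Kstep z w : z \in K -> w \in E -> edge z w -> w \in K.
  move=> zK wE zw; have zE := KE _ zK; move: zK; rewrite !inE => yz.
  by apply: connect_trans yz _; apply: within1.
(* Since A(G) lies in [border s], off [E], a vertex of D(G) in [K] would spread D(G) along [K] to
   [h], a core vertex. *)
have KD z : z \in K -> z \notin D0.
  move=> zK; apply/negP=> zD; have /coreP[] := fcomp_core sC hH; case/negP.
  apply: (connect_stable (P := mem D0) _ (Kh _ zK) zD) => a b /and3P[_ bE ab] aD.
  have [//|bA] := neighbours_or aD ab.
  by have := subsetP (barrier_border sD) _ bA => /border_notin; rewrite bE.
(* An allowed edge leaving [E] ends at some [b] in [border s]. The path from [a] to [h] stays in
   [cofree b], which [H] leaves through some [c] in [border b]; then [cofree c = E] forces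
   [cofree b = E], so [b] is in [H]. *)
have Kallowed a b : allowed a b -> a \in K -> b \in K \/ b \in H.
  move=> ab aK; have aE := KE _ aK; have [eab [f fo fab]] := allowedP _ _ ab.
  have [bE|bB] := neighbours_or aE eab; first by left; apply: Kstep eab.
  right; have bD := border_exposable sD bB.
  have subb := border_cofree_sub sD bB.
  have aEb : a \in cofree b.
    by rewrite -[a](mating_inv (optimal_mating fo)) fab; exact: mate_cofree.
  have sEb : s \notin cofree b by rewrite -cofree_sym border_notin.
  have hEb : h \in cofree b.
    apply: (connect_stable (P := mem (cofree b)) _ (Kh _ aK) aEb) => c d /and3P[_ dE cd] cb.
    have [//|dB] := neighbours_or cb cd.
    by have := subsetP (border_sub sD bB) _ dB => /border_notin; rewrite dE.
  have hs : factor_connected h s by rewrite fconnC -in_fcomp.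
  have [c cB hc] := fconn_exit hs hEb sEb.
  have cH : c \in H.
    by rewrite in_fcomp; rewrite in_fcomp in hH; apply: connect_trans hH hc.
  have cE : c \notin cofree s by apply: border_notin; apply: subsetP (border_sub sD bB) _ cB.
  have Ec := fcomp_cofree sC cH cE.
  rewrite in_fcomp; apply: cofree_eq_fconn => //; apply/eqP; rewrite eqEsubset subb andbT.
  by rewrite -Ec; exact: border_cofree_sub.
have Xc : allowed_closed (H :|: K).
  move=> a b ab /setUP[aH|aK]; first by rewrite inE (fcomp_closed ab aH).
  by case: (Kallowed _ _ ab aK); rewrite in_setU => ->; rewrite ?orbT.
set Z := K :\: H.
have XZ : (H :|: K) :\: H = Z.
  by apply/setP=> z; rewrite !in_setD in_setU; case: (z \in H).
have Zc : allowed_closed Z by rewrite -XZ; exact: closedD.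
have [f fo] := optimal_ex (set0 : {set G}); have fm := optimal_mating fo.
have fZ z : (f z \in Z) = (z \in Z) := component_closed z Zc fo.
pose p : {ffun G -> G} := [ffun z => if z \in Z then f z else z].
have pm : mating (~: Z) p.
  apply/matingP; split=> [z|z|z].
  - rewrite !ffunE; case: (boolP (z \in Z)) => zZ; last by rewrite (negPf zZ).
    by rewrite fZ zZ (mating_inv fm).
  - by rewrite ffunE; case: ifP => _; [exact: mating_edge fm | rewrite eqxx].
  by rewrite inE ffunE => /negPf->.
have pE : fixes p = ~: Z.
  apply/setP=> z; rewrite in_fixes in_setC ffunE; case: (boolP (z \in Z)) => zZ; last by rewrite eqxx.
  by apply/negbTE; apply: optimal_notin fo _; apply: KD; move: zZ; rewrite inE => /andP[].
suff le : fc_le H (fcomp y).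
  apply/bigcupP; exists (fcomp y); last exact: fcomp_refl.
  rewrite fcomp_component le /=; apply: contraNneq yH => <-; exact: fcomp_refl.
apply/fc_leP; exists (H :|: K); split=> //.
  rewrite subUset subsetUl; apply: closed_fcomp => //.
  by rewrite in_setU yK orbT.
apply/contract_criticalP; first exact: subsetUl.
rewrite XZ; split; first by exists p.
move=> x xZ; have /setDP[xK xH] := xZ.
have xE := KE _ xK.
have [xs [g [gm gs gx cg]]] := cofreeP _ _ xE.
(* As [g] exposes [s] and [x], [tight_eq] forbids it to miss another vertex of [K] or to match it
   into the barrier. *)
have inner z : z \in K -> z != x -> g z != z /\ g z \in K.
  move=> zK zx; have zE := KE _ zK.
  have bad : ~ ((g z == z) || (g z \in border s)).
    move=> gz; apply: (@tight_eq _ s g x z sD gm) => //.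
    - apply: leq_trans cg _; rewrite leq_add2l -[2]/(2 * 1) leq_mul2l /= card_gt0.
      by apply/set0Pn; exists s; rewrite inE border_self // inE gs eqxx.
    - by apply: connect_trans (Kh _ xK) _; rewrite within_sym; exact: Kh.
    - by rewrite eq_sym.
    - by rewrite gx eqxx.
  have gz : g z != z by apply/negP=> gz; apply: bad; rewrite gz.
  split=> //; have ez := mating_edge gm gz.
  have [gE|gB] := neighbours_or zE ez; first exact: Kstep ez.
  by case: bad; rewrite /border gB orbT.
pose q : {ffun G -> G} := [ffun z => if (z \in Z) && (g z \in Z) then g z else z].
have qm : mating (~: Z) q.
  apply/matingP; split=> [z|z|z].
  - rewrite !ffunE; case: (boolP ((z \in Z) && (g z \in Z))) => [/andP[zZ gZ]|/negPf->//].
    by rewrite (mating_inv gm) zZ gZ.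
  - by rewrite ffunE; case: ifP => _; [exact: mating_edge gm | rewrite eqxx].
  by rewrite inE ffunE => /negPf->.
have qx : q x = x by rewrite ffunE gx if_same.
have px : p x != x by rewrite -in_fixes pE inE xZ.
(* [p] misses nothing in [Z], so the path ends at a [w] in [Z] that [q] misses, which means that [g]
   matches [w] into [H]; [p'] then misses exactly [x] and [w] in [Z]. *)
have [p' [q' [w [p'm q'm _ wx kind]]]] := exchange pm qm qx px.
have outZ (r : {ffun G -> G}) : mating (~: Z) r -> r w != w -> w \in Z.
  by move=> rm; apply: contraR => wZ; apply/eqP; apply: mating_fix rm _; rewrite inE.
case: kind => [[pw Ep' _ _ _]|[qw Ep' Eq' _ _]].
  have wZ : w \in Z by apply: outZ p'm _; rewrite -in_fixes Ep' !inE eqxx (negPf wx).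
  by have : w \in fixes p; [rewrite inE pw | rewrite pE inE wZ].
have wZ : w \in Z by apply: outZ q'm _; rewrite -in_fixes Eq' !inE eqxx.
have /setDP[wK wH] := wZ.
have [gw gwK] := inner w wK wx.
have gwH : g w \in H.
  apply: contraNT gw => gwH; move/eqP: qw; rewrite ffunE wZ.
  by rewrite inE gwH gwK.
exists w, (g w), p'; split=> //; first exact: mating_edge gm gw.
by rewrite Ep' pE setUA setUC.
Qed.

(** A neighbour in [E] would be joined within [E] to [H], hence lie in [H] or in [U]. Inside [H] it
    belongs to [upper]; inside [U] but off [upper] it belongs to [Ubase], whose neighbours among the
    upper bounds avoid [upper]. *)
Lemma upper_neighbours y : y \in neighbours upper -> y \notin E.
Proof.
case/neighboursP=> yN [v vU vy]; apply/negP=> yE.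
have [vE [h [hH hS vh]]] := upper_connected vU.
have yH : y \notin H.
  apply: contra yN => yH; apply/upperP; left; split=> //.
  by apply/negP=> /gkl_class_notin; rewrite yE.
have hE := gkl_classN hH hS.
have yv : edge y v by rewrite edge_sym.
have yU : y \in U.
  apply: cofree_upper_strict hH hE _ => //.
  by apply: connect_trans vh; apply: within1.
case/negP: yN; apply/upperP; right; split=> //; apply/negP=> yB.
have vUn : v \in Unonstrict H by move: vU; rewrite !in_setD => /and3P[].
have vNS : v \notin gkl_class by move: vU; rewrite !in_setD => /and3P[].
have vNB : v \notin Ubase H gkl_class by move: vU; rewrite !in_setD => /and3P[].
by case: (Ubase_neighbour yB vy vUn) => h'; [rewrite h' in vNS | rewrite h' in vNB].
Qed.

End Consistent.

End UpperBounds.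

(** * DM components *)

Section DMComponents.
Variable G : sgraph.
Implicit Types (H S : {set G}) (s x y : G) (C : dm_component G).

Notation D0 := (@exposable G set0).
Notation A0 := (neighbours (@exposable G set0)).

Lemma gkl_classE x : x \in core G -> gkl_class x = [set y in ~: Dset G | gkl x y].
Proof.
move=> xC; have xD := core_exposable xC; apply/setP=> y; rewrite [LHS]inE [RHS]inE in_fcomp in_setC DsetE.
apply/andP/andP=> [[xy E]|[yD]].
  have yD := core_exposable (fconn_core xy xC).
  by split=> //; rewrite gklE // xy eq_sym.
by rewrite gklE // => /andP[xy]; rewrite eq_sym.
Qed.

Lemma fcomp_exceptional s : s \in core G -> exceptional (fcomp s) = false.
Proof.
move=> sC; apply/negbTE; rewrite negb_and negbK DsetE; apply/orP; left.
apply/eqP/setP=> x; rewrite in_setI in_set0; apply/negP=> /andP[xs].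
by apply/negP/core_exposable/(fcomp_core sC xs).
Qed.

Lemma core_dm_base s : s \in core G -> is_dm_base (fcomp s, gkl_class s).
Proof.
move=> sC; rewrite /is_dm_base /= fcomp_component /gkl_of fcomp_exceptional //= inE.
apply/andP; split; last by apply/subsetP=> x; rewrite inE => /andP[].
rewrite gkl_classE //; apply: imset_f.
by rewrite in_setC DsetE core_exposable.
Qed.

(** Avoiding D(G) amounts to this: maximum matchings match A(G) into D(G), so a factor-component
    that meets A(G) meets D(G). *)
Definition consistent C := (val C).1 \subset core G.

Lemma self_gkl_class s : s \in gkl_class s.
Proof. by rewrite inE fcomp_refl eqxx. Qed.

Lemma dm_nonexceptional C : exceptional (val C).1 = false ->
  exists x, [/\ x \notin D0, x \in dm_base C, (val C).1 = fcomp x &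
    forall y, (y \in dm_base C) = (y \notin D0) && factor_connected x y && (cofree x == cofree y)].
Proof.
case: C => [[H S] /= HS] exc; rewrite /dm_base /=.
move: HS; rewrite /is_dm_base /gkl_of /= exc => /andP[HF]; rewrite inE => /andP[SC SH].
have [x xD SE] := imsetP SC.
have xD0 : x \notin D0 by move: xD; rewrite in_setC DsetE.
have mem y : (y \in S) = (y \notin D0) && factor_connected x y && (cofree x == cofree y).
  rewrite SE 2!inE DsetE; case: (boolP (y \in D0)) => //= yD.
  by rewrite gklE.
have xS : x \in S by rewrite mem xD0 eqxx andbT; exact: connect0.
exists x; split=> //; apply: component_fcomp => //; exact: subsetP SH _ xS.
Qed.

Lemma consistentP C : consistent C -> exists s,
  [/\ s \in core G, (val C).1 = fcomp s, dm_base C = gkl_class s & dm_topU C = upper s].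
Proof.
move=> CC.
have exc : exceptional (val C).1 = false.
  have /andP[HF _] := valP C; have [x xE] := component_ex HF.
  rewrite xE; apply: fcomp_exceptional; apply: (subsetP CC); rewrite xE; exact: fcomp_refl.
have [x [xD xB HE SE]] := dm_nonexceptional exc.
have xC : x \in core G by apply: (subsetP CC); rewrite HE fcomp_refl.
have SE' : dm_base C = gkl_class x.
  apply/setP=> y; rewrite SE [RHS]inE in_fcomp [in RHS]eq_sym; apply/idP/idP.
    by case/andP=> /andP[_ ->].
  by case/andP=> xy ->; rewrite xy (core_exposable (fconn_core xy xC)).
exists x; split=> //; rewrite /dm_topU /topU exc.
by move: SE'; rewrite /dm_base => ->; rewrite HE.
Qed.

Lemma noncoreP x : x \notin core G -> x \in D0 \/ x \in A0.
Proof. by rewrite in_setC negbK => /setUP. Qed.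

Lemma allowed_barrier y v : y \in A0 -> v \in D0 -> edge v y -> allowed v y.
Proof.
move=> yA vD vy; rewrite allowed_sym; apply: allowed_cofree; last by rewrite edge_sym.
by rewrite barrier_cofree.
Qed.

Lemma Ustrict_core s x : x \in Ustrict (fcomp s) -> x \in core G.
Proof.
move=> xU; have [xD _ _] := upper_witness xU.
apply/coreP; split=> //; apply/negP=> xA.
have [f fo] := optimal_ex (set0 : {set G}).
have fU : f x \in Ustrict (fcomp s).
  by rewrite (component_closed _ (@Ustrict_closed _ _) fo).
have [fD _ _] := upper_witness fU.
by case/negP: fD; rewrite -(barrier_cofree xA) mate_cofree.
Qed.

(** Strict upper bounds lie in the core, which has no edge to D(G); so none of them is attached to
    the factor-component outside the base, and none enters [dm_topU C]. *)
Lemma inconsistentP C : ~~ consistent C ->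
  [/\ [disjoint (val C).1 & core G], dm_base C = (val C).1 :&: A0 & dm_topU C \subset (val C).1 :&: D0].
Proof.
case/subsetPn=> x0 x0H x0C.
have /andP[HF HB] := valP C.
have HE := component_fcomp HF x0H.
have dis : [disjoint (val C).1 & core G].
  apply/pred0P=> x /=; apply/negP=> /andP[xH xC]; case/negP: x0C.
  by apply: (fcomp_core xC); rewrite HE in xH; rewrite (fcomp_eq xH) fcomp_refl.
have ncore x : x \in (val C).1 -> x \in D0 \/ x \in A0.
  move=> xH; apply: noncoreP; apply/negP=> xC.
  by have /pred0P/(_ x) := dis; rewrite /= xH xC.
case: (boolP (exceptional (val C).1)) => exc; split=> //.
- by move: HB; rewrite /gkl_of exc inE /Aset DsetE => /eqP.
- by rewrite /dm_topU /topU exc DsetE.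
- have [x [xD xB xE SE]] := dm_nonexceptional (negbTE exc).
  have xA : x \in A0 by case: (ncore x); rewrite ?xE ?fcomp_refl // (negPf xD).
  apply/setP=> y; rewrite SE in_setI xE in_fcomp (barrier_cofree xA).
  apply/idP/idP=> [/andP[/andP[yD xy] _]|/andP[xy yA]].
    by rewrite xy; case: (ncore y); rewrite ?xE ?in_fcomp // (negPf yD).
  by rewrite xy barrier_cofree // eqxx andbT andbT; case/neighboursP: yA.
have [x [xD xB xE SE]] := dm_nonexceptional (negbTE exc).
have xA : x \in A0 by case: (ncore x); rewrite ?xE ?fcomp_refl // (negPf xD).
have hD h : h \in fcomp x -> h \notin dm_base C -> h \in D0.
  move=> hx hB; case: (ncore h); rewrite ?xE // => hA; case/negP: hB.
  rewrite SE; rewrite in_fcomp in hx; rewrite hx !barrier_cofree // eqxx andbT andbT.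
  by case/neighboursP: hA.
rewrite /dm_topU /topU (negbTE exc) -/(dm_base C) xE.
apply/subsetP=> y; rewrite !in_setD UnonstrictE => /and3P[yB yS /setUP[yx|yU]].
  by rewrite in_setI yx hD.
have [k [h [yk hx hS kh]]] := notin_Ubase yU yB.
have kU : k \in Ustrict (fcomp x) := within_mem yk yU.
have /coreP[kD kA] := Ustrict_core kU.
have hk : edge h k by rewrite edge_sym.
by case: (neighbours_or (hD _ hx hS) hk); rewrite ?(negPf kD) ?(negPf kA).
Qed.

Lemma dm_base_sub C : dm_base C \subset (val C).1.
Proof.
case: (boolP (consistent C)) => [/consistentP[s [_ -> -> _]]|/inconsistentP[_ -> _]].
  by apply/subsetP=> x; rewrite inE => /andP[].
exact: subsetIl.
Qed.

Lemma dm_base_exposable C y : y \in dm_base C -> y \notin D0.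
Proof.
case: (boolP (consistent C)) => [/consistentP[s [sC _ -> _]]|/inconsistentP[_ -> _]].
  by rewrite inE => /andP[/(fcomp_core sC)/core_exposable].
by case/setIP=> _ /neighboursP[].
Qed.

Lemma dm_base_cofree C x y : x \in dm_base C -> y \in dm_base C -> cofree x = cofree y.
Proof.
case: (boolP (consistent C)) => [/consistentP[s [_ _ -> _]]|/inconsistentP[_ -> _]].
  by rewrite !inE => /andP[_ /eqP->] /andP[_ /eqP->].
by move=> /setIP[_ xA] /setIP[_ yA]; rewrite !barrier_cofree.
Qed.

(** An edge from D(G) to A(G) is allowed, so both bases lie in one factor-component, which
    determines the base. *)
Lemma inconsistent_le0 C1 C2 : ~~ consistent C1 -> dm_le0 C1 C2 -> C1 = C2.
Proof.
move=> C1N /orP[/eqP//|/set0Pn[y /setIP[yN yB2]]].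
have [dis E1 sub1] := inconsistentP C1N.
have [_ [v vT vy]] := neighboursP _ _ yN.
have /setIP[vH vD] := subsetP sub1 _ vT.
have yA : y \in A0.
  have [yD|//] := neighbours_or vD vy.
  by have := dm_base_exposable yB2; rewrite yD.
have av := allowed_barrier yA vD vy.
have /andP[HF1 _] := valP C1; have /andP[HF2 _] := valP C2.
have yH1 : y \in (val C1).1.
  by rewrite (component_fcomp HF1 vH) in_fcomp; apply: connect1.
have HE : (val C1).1 = (val C2).1.
  rewrite (component_fcomp HF1 yH1) -(component_fcomp HF2) //.
  exact: subsetP (dm_base_sub C2) _ yB2.
have C2N : ~~ consistent C2 by rewrite /consistent -HE.
have [_ E2 _] := inconsistentP C2N.
have SE : dm_base C1 = dm_base C2 by rewrite E1 E2 HE.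
apply: val_inj; move: HE SE; rewrite /dm_base.
by case: (val C1) => a b; case: (val C2) => c d /= -> ->.
Qed.

Lemma dm_leP C1 C2 : dm_le C1 C2 <-> connect (@dm_le0 G) C1 C2.
Proof.
split=> [[p [pp pl]]|/connectP[p pp pl]]; last by exists p.
by apply/connectP; exists p.
Qed.

Lemma inconsistent_le C1 C2 : ~~ consistent C1 -> connect (@dm_le0 G) C1 C2 -> C1 = C2.
Proof.
move=> C1N /connectP[p]; elim: p => [|C p IHp] /=; first by move=> _ ->.
by case/andP=> /(inconsistent_le0 C1N)<-.
Qed.

(** For consistent [C1] with class of [s], a neighbour of [upper s] is outside [cofree s], hence in
    [border s], and [border_cofree_sub] applies. *)
Lemma dm_le0_cofree C1 C2 : dm_le0 C1 C2 -> C1 = C2 \/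
  exists2 y, y \in dm_base C2 & forall x, x \in dm_base C1 -> cofree y \subset cofree x.
Proof.
move=> le; case: (boolP (consistent C1)) => [C1C|/inconsistent_le0]; last by left; auto.
move: le => /orP[/eqP->|/set0Pn[y /setIP[yN yB2]]]; first by left.
have [s [sC _ SE TE]] := consistentP C1C.
rewrite TE in yN; have yE := upper_neighbours sC yN.
have [_ [v vT vy]] := neighboursP _ _ yN.
right; exists y => // x; rewrite SE inE => /andP[_ /eqP->].
apply: border_cofree_sub; first exact: core_exposable.
by case: (neighbours_or (upper_cofree sC vT) vy) => // yE'; rewrite yE' in yE.
Qed.

Lemma dm_le_cofree C1 C2 x y : connect (@dm_le0 G) C1 C2 -> x \in dm_base C1 ->
  y \in dm_base C2 -> cofree y \subset cofree x.
Proof.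
case/connectP=> p; elim: p C1 x => [|C p IHp] C1 x /=.
  by move=> _ -> xB yB; rewrite (dm_base_cofree xB yB).
case/andP=> /dm_le0_cofree[->|[z zB sub]] pp ly xB yB; first exact: IHp pp ly xB yB.
exact: subset_trans (IHp _ _ pp ly zB yB) (sub _ xB).
Qed.

Lemma dm_le_antisym C1 C2 : connect (@dm_le0 G) C1 C2 -> connect (@dm_le0 G) C2 C1 -> C1 = C2.
Proof.
move=> le12 le21; case: (boolP (consistent C1)) => C1C; last exact: inconsistent_le.
case: (boolP (consistent C2)) => C2C; last by symmetry; exact: inconsistent_le.
have [s [sC HE1 SE1 _]] := consistentP C1C; have [t [tC HE2 SE2 _]] := consistentP C2C.
have sB : s \in dm_base C1 by rewrite SE1 self_gkl_class.
have tB : t \in dm_base C2 by rewrite SE2 self_gkl_class.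
have E : cofree s = cofree t.
  by apply/eqP; rewrite eqEsubset (dm_le_cofree le21 tB sB) (dm_le_cofree le12 sB tB).
have st := cofree_eq_fconn sC (core_exposable tC) E.
have FE : fcomp t = fcomp s by apply: fcomp_eq; rewrite in_fcomp.
have SE : gkl_class t = gkl_class s by rewrite /gkl_class FE E.
apply: val_inj; move: HE1 HE2 SE1 SE2; rewrite FE SE /dm_base.
by case: (val C1) => a b; case: (val C2) => c d /= -> -> -> ->.
Qed.

Lemma upper_core s x : s \in core G -> x \in upper s -> x \in core G.
Proof.
move=> sC /upperP[[xs _]|[xU _]]; first exact: fcomp_core xs.
exact: Ustrict_core xU.
Qed.

Lemma upper_gkl_class s x : x \in upper s -> x \notin gkl_class s.
Proof. by rewrite !in_setD => /and3P[]. Qed.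

(** The base of [C2] lies in [upper s], hence in [cofree s], for [s] in the base of the intermediate
    [C], and [cofree] shrinks along [dm_le]. A vertex of that base is outside D(G), which rules out
    inconsistent [C]. *)
Lemma dm_forbid_cofree C1 C2 : dm_forbid C1 C2 ->
  [/\ consistent C1, consistent C2 &
      forall x y, x \in dm_base C1 -> y \in dm_base C2 -> y \in cofree x].
Proof.
case=> C [/dm_leP le [/set0Pn[y yB] sub]].
have topU_mem z : z \in dm_base C2 -> z \in dm_topU C.
  move=> /(subsetP sub); rewrite in_setD => /andP[zB]; rewrite in_setU (negPf zB) //.
have CC : consistent C.
  apply: contraT => /inconsistentP[_ _ /subsetP/(_ _ (topU_mem _ yB))/setIP[_ yD]].
  by have := dm_base_exposable yB; rewrite yD.
have [s [sC _ SE TE]] := consistentP CC.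
split.
- by apply: contraTT CC => C1N; rewrite -(inconsistent_le C1N le).
- apply: contraT => /inconsistentP[/pred0P/(_ y) /= dis _ _].
  have yC : y \in core G by apply: upper_core sC _; rewrite -TE topU_mem.
  by move: dis; rewrite yC (subsetP (dm_base_sub C2) _ yB).
move=> x z xB zB; have sB : s \in dm_base C by rewrite SE self_gkl_class.
apply: (subsetP (dm_le_cofree le xB sB)).
by apply: upper_cofree; rewrite // -TE topU_mem.
Qed.

Lemma upper_saturated s x y : s \in core G -> x \in upper s -> y \in gkl_class x -> y \in upper s.
Proof.
move=> sC xU; rewrite inE => /andP[yx /eqP E].
have FE := fcomp_eq yx.
apply/upperP; case: (upperP _ _ xU) => [[xs xS]|[xUs xB]].
  left; split; first by rewrite -(fcomp_eq xs).
  by apply: contra xS; rewrite inE => /andP[_]; rewrite E inE xs.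
right; split; first exact: subsetP (closed_fcomp (@Ustrict_closed _ _) xUs) _ yx.
apply: contra xB => /bigcupP[H' /andP[H'F h] yH']; apply/bigcupP; exists H'; first by rewrite H'F.
by rewrite (component_fcomp H'F yH') FE fcomp_refl.
Qed.

(** The sets [dm_topU C] over consistent [C] above [C1], with D(G), satisfy [cofree_closure]; so [t]
    lies in one of them, and by [upper_saturated] its whole class does. *)
Lemma cofree_forbid C1 C2 s t : consistent C1 -> consistent C2 ->
  s \in dm_base C1 -> t \in dm_base C2 -> t \in cofree s -> dm_forbid C1 C2.
Proof.
move=> C1C C2C sB tB ts; have sD := dm_base_exposable sB.
have [f fo] := optimal_ex (set0 : {set G}).
pose P C := connect (@dm_le0 G) C1 C && consistent C.
have /subsetP/(_ _ ts) : cofree s \subset D0 :|: \bigcup_(C | P C) dm_topU C.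
  apply: (@cofree_closure _ f s _ (A0 :|: \bigcup_(C | P C) dm_base C)) => //.
  - rewrite subUset exposable_cofree //; apply/bigcupsP=> C /andP[le CC].
    have [r [rC _ SE ->]] := consistentP CC; apply/subsetP=> z /(upper_cofree rC).
    apply: (subsetP (dm_le_cofree le sB _)).
    by rewrite SE self_gkl_class.
  - rewrite subUset barrier_border //; apply/bigcupsP=> C /andP[le CC].
    apply/subsetP=> z zB; apply: cofree_sub_border; first exact: dm_base_exposable zB.
    exact: dm_le_cofree le sB zB.
  - apply/setUP; right; apply/bigcupP; exists C1 => //.
    by rewrite /P C1C connect0.
  - exact: subsetUl.
  - apply/subsetP=> x /neighboursP[xN [y yY yx]]; rewrite in_setU.
    have xD : x \notin D0 by apply: contra xN => xD; rewrite in_setU xD.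
    case: (boolP (x \in A0)) => //= xA.
    case/setUP: yY => [yD|/bigcupP[C /andP[le CC] yT]].
      by case: (neighbours_or yD yx); rewrite ?(negPf xD) ?(negPf xA).
    have xC : x \in core G by apply/coreP.
    (* A boundary vertex in the core belongs to the base of a DM component directly above [C]. *)
    pose Cx : dm_component G := Sub (fcomp x, gkl_class x) (core_dm_base xC).
    have xT : x \in neighbours (dm_topU C).
      have [xT|//] := neighbours_or yT yx; case/negP: xN.
      by apply/setUP; right; apply/bigcupP; exists C; rewrite // /P le.
    apply/bigcupP; exists Cx; last exact: self_gkl_class.
    apply/andP; split.
      apply: connect_trans le (connect1 _); apply/orP; right; apply/set0Pn; exists x.
      by rewrite in_setI xT; exact: self_gkl_class.
    by apply/subsetP=> z /= zx; apply: fcomp_core zx.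
  move=> b /setUP[bA|/bigcupP[C /andP[le CC] bB]]; apply/setUP.
    by left; rewrite -(barrier_cofree bA) mate_cofree //; case/neighboursP: bA.
  right; apply/bigcupP; exists C; first by rewrite /P le.
  have bD := dm_base_exposable bB.
  have [r [rC _ SE ->]] := consistentP CC; rewrite SE in bB.
  move: bB; rewrite inE => /andP[br /eqP E].
  (* The mate of [b] stays in the factor-component of [b] and lies in [cofree b], hence outside the
     class of [b]. *)
  apply/upperP; left; split.
    rewrite in_fcomp in br; rewrite in_fcomp; apply: connect_trans br _; exact: fconn_mate.
  by apply/negP=> /gkl_class_notin; rewrite -E mate_cofree.
rewrite in_setU (negPf (dm_base_exposable tB)) /= => /bigcupP[C /andP[le CC] tT].
exists C; split; first exact/dm_leP.
split; first by apply/set0Pn; exists t.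
have [r [rC _ SE TE]] := consistentP CC.
have [q [qC HE2 SE2 _]] := consistentP C2C.
have clE : gkl_class q = gkl_class t.
  move: tB; rewrite SE2 inE => /andP[tq /eqP E].
  by rewrite /gkl_class (fcomp_eq tq) E.
rewrite TE in tT; apply/subsetP=> y; rewrite SE2 clE => yt.
have yU := upper_saturated rC tT yt.
by rewrite in_setD SE (upper_gkl_class yU) in_setU TE yU orbT.
Qed.

End DMComponents.

Theorem theorem5p14 (G : sgraph) :
  tfr_poset (@dm_le G) (@dm_forbid G).
Proof.
split.
- split=> [C|C1 C2 /dm_leP le12 /dm_leP le21|C1 C2 C3 /dm_leP le12 /dm_leP le23].
  + exact/dm_leP/connect0.
  + exact: dm_le_antisym.
  + exact/dm_leP/(connect_trans le12).
- move=> C1 C2 C3 /dm_leP le12 [C [/dm_leP le2 h]]; exists C; split=> //.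
  exact/dm_leP/(connect_trans le12).
- move=> C h; have [CC _ E] := dm_forbid_cofree h.
  have [s [_ _ SE _]] := consistentP CC.
  have sB : s \in dm_base C by rewrite SE self_gkl_class.
  by have := E _ _ sB sB; rewrite (negPf (cofree_irr s)).
move=> C1 C2 h; have [C1C C2C E] := dm_forbid_cofree h.
have [s [_ _ SE1 _]] := consistentP C1C; have [t [_ _ SE2 _]] := consistentP C2C.
have sB : s \in dm_base C1 by rewrite SE1 self_gkl_class.
have tB : t \in dm_base C2 by rewrite SE2 self_gkl_class.
by apply: (cofree_forbid C2C C1C tB sB); rewrite cofree_sym; apply: E.
Qed.
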